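(* Let $\Gamma \leq \mathrm{Diff}_{+}(I)$ be a finitely generated, locally transitive, irreducible subgroup such that every non-identity element of $\Gamma$ has finitely many fixed points. Then either $\Gamma$ is isomorphic (as a group) to a subgroup of $\mathrm{Aff}_{+}(\mathbb{R})$, or $\Gamma$ has infinite girth.
   Context: $I=[0,1]$, and $\mathrm{Diff}_{+}(I)$ is the group of orientation preserving $C^1$-diffeomorphisms of $I$. $\mathrm{Aff}_{+}(\mathbb{R})$ is the group of all maps $x\mapsto ax+b$ of $\mathbb{R}$ with $a>0$, $b\in\mathbb{R}$. For a homeomorphism $f$ of $I$, $||f||=\sup_{x\in[0,1]}|f(x)-x|$. A subgroup $\Gamma$ is irreducible if it has no global fixed point in $(0,1)$, i.e. no point of $(0,1)$ is fixed by all elements of $\Gamma$. A subgroup $\Gamma\leq\mathrm{Diff}_{+}(I)$ is locally transitive if for all $p\in(0,1)$ and all $\epsilon>0$ there exists $\gamma\in\Gamma$ such that $||\gamma||<\epsilon$ and $\gamma(p)\neq p$. The girth of a graph is the length of a shortest cycle in it (equal to $\infty$ if there is no cycle). The girth of a finitely generated group $\Gamma$ is $$girth(\Gamma)=\sup\{girth(\mathcal{G}(\Gamma,S)) : \langle S\rangle=\Gamma,\ |S|<\infty\},$$ where $\mathcal{G}(\Gamma,S)$ is the Cayley graph of $\Gamma$ with respect to the finite generating set $S$. ''Either ... or'' is inclusive. *)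

(* Defs.v *)
From HB Require Import structures.
From mathcomp Require Import all_boot all_order all_algebra.
From mathcomp Require Import all_classical all_reals all_analysis.

Set Implicit Arguments.
Unset Strict Implicit.
Unset Printing Implicit Defensive.

Import Order.TTheory GRing.Theory Num.Theory.
Import numFieldNormedType.Exports.

Local Open Scope classical_set_scope.
Local Open Scope ring_scope.

(* The group of all bijections of a possibly infinite type T, the product being
   composition: (f * g) x = f (g x).  Diff_+(I) and Aff_+(R) are introduced
   below as subsets of Sym I and Sym R. *)
Record Sym (T : Type) := MkSym { sym_fun :> T -> T; sym_bij : bijective sym_fun }.

Lemma symP (T : Type) (f g : Sym T) : (forall x, f x = g x) -> f = g.
Proof.
case: f g => [f bf] [g bg] /= /funext fg; case: g / fg bg => bg.
by rewrite (Prop_irrelevance bf bg).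
Qed.

Lemma sym_inv_ex (T : Type) (f : Sym T) : exists g : Sym T, cancel f g /\ cancel g f.
Proof.
case: f => f /= [g fK gK].
by exists (MkSym (Bijective gK fK)).
Qed.

Definition sym_one (T : Type) : Sym T :=
  MkSym (Bijective (fun x : T => erefl (id x)) (fun x : T => erefl (id x))).
Definition sym_mul (T : Type) (f g : Sym T) : Sym T :=
  MkSym (bij_comp (sym_bij f) (sym_bij g)).
Definition sym_inv (T : Type) (f : Sym T) : Sym T := sval (cid (sym_inv_ex f)).

Lemma sym_funK (T : Type) (f : Sym T) : cancel f (sym_inv f).
Proof. by rewrite /sym_inv; case: cid => g []. Qed.

Lemma sym_invK (T : Type) (f : Sym T) : cancel (sym_inv f) f.
Proof. by rewrite /sym_inv; case: cid => g []. Qed.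

Lemma sym_mulA (T : Type) : associative (@sym_mul T).
Proof. by move=> f g h; apply: symP. Qed.

Lemma sym_mul1 (T : Type) : left_id (sym_one T) (@sym_mul T).
Proof. by move=> f; apply: symP. Qed.

Lemma sym_1mul (T : Type) : right_id (sym_one T) (@sym_mul T).
Proof. by move=> f; apply: symP. Qed.

Lemma sym_mulV (T : Type) : left_inverse (sym_one T) (@sym_inv T) (@sym_mul T).
Proof. by move=> f; apply: symP; exact: sym_funK. Qed.

Lemma sym_Vmul (T : Type) : right_inverse (sym_one T) (@sym_inv T) (@sym_mul T).
Proof. by move=> f; apply: symP; exact: sym_invK. Qed.

HB.instance Definition _ (T : Type) := gen_eqMixin (Sym T).
HB.instance Definition _ (T : Type) := gen_choiceMixin (Sym T).
HB.instance Definition _ (T : Type) := isGroup.Build (Sym T)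
  (@sym_mulA T) (@sym_mul1 T) (@sym_1mul T) (@sym_mulV T) (@sym_Vmul T).

Definition subgroup (G : groupType) (H : set G) : Prop := group_closed [in H].

Definition generated (G : groupType) (S : set G) : set G :=
  smallest (@subgroup G) S.

Definition finitely_generated (G : groupType) (H : set G) : Prop :=
  exists2 S : set G, finite_set S & generated S = H.

Definition isomorphic (G G' : groupType) (H : set G) (H' : set G') : Prop :=
  exists2 phi : G -> G',
    {in H &, {morph phi : x y / (x * y)%g}} & set_bij H H' phi.

(* The shortest cycle of a simple graph given by a symmetric irreflexive
   adjacency relation; the value is +oo when there is no cycle. *)
Definition graph_girth (R : realType) (V : eqType) (adj : rel V) : \bar R :=
  ereal_inf [set (size c)%:R%:E | c in [set c | ucycle adj c /\ (3 <= size c)%N]].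

(* The undirected simple graph with vertex set H in which g and h are adjacent
   when h = g s or g = h s for some s in S; a generator equal to 1 gives no
   loop, and two mutually inverse generators give a single edge. *)
Definition cayley_graph (G : groupType) (H S : set G) : rel G :=
  fun g h => [&& g \in H, h \in H, g != h &
                 ((g^-1 * h)%g \in S) || ((h^-1 * g)%g \in S)].

Definition girth (R : realType) (G : groupType) (H : set G) : \bar R :=
  ereal_sup [set graph_girth R (cayley_graph H S) |
             S in [set S | finite_set S /\ generated S = H]].

(* I = [0,1], carrying the subspace topology *)
Definition itv01 (R : realType) : set R := `[0, 1].
Arguments itv01 R : clear implicits.

(* Continuously differentiable on [0,1]: as y ranges over [0,1], the
   derivatives at 0 and at 1 are one-sided. *)
Definition C1 (R : realType) (f : itv01 R -> itv01 R) : Prop :=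
  exists2 f' : itv01 R -> R, continuous f' &
    forall x : itv01 R,
      (\val (f y) - \val (f x)) / (\val y - \val x) @[y --> x^'] --> f' x.

Definition Diff_plus (R : realType) : set (Sym (itv01 R)) :=
  [set f : Sym (itv01 R) | [/\ C1 f, C1 (f^-1)%g &
    {homo (f : itv01 R -> itv01 R) : x y / \val x < \val y}]].

Definition Aff_plus (R : realType) : set (Sym R) :=
  [set f : Sym R | exists a b : R, 0 < a /\ forall x, f x = a * x + b].

(* ||f|| = sup_{x in [0,1]} |f(x) - x| *)
Definition dist_id (R : realType) (f : itv01 R -> itv01 R) : R :=
  sup [set `|\val (f x) - \val x| | x in [set: itv01 R]].

Definition irreducible (R : realType) (H : set (Sym (itv01 R))) : Prop :=
  ~ exists p : itv01 R, 0 < \val p < 1 /\ forall g, H g -> g p = p.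

Definition locally_transitive (R : realType) (H : set (Sym (itv01 R))) : Prop :=
  forall p : itv01 R, 0 < \val p < 1 -> forall eps : R, 0 < eps ->
    exists g, [/\ H g, dist_id g < eps & g p <> p].

(* Main.v *)
Require Import Defs.
From HB Require Import structures.
From mathcomp Require Import all_boot all_order all_algebra.
From mathcomp Require Import all_classical all_reals all_analysis.
From mathcomp Require Import ring lra zify.

(* Comparing elements near 0 turns Gamma into a bi-ordered group.  If the chains of Archimedean
   classes have bounded length, Hoelder's theorem applies to the lowest class and to its
   centralizer, which acts freely on (0,1); conjugation rescales the resulting translation numbers,
   and this yields an embedding into Aff_+(R).  Otherwise, long chains give elements that move many
   long intervals alternately to the right and to the left, where long means that no generator maps
   the left end of an interval beyond its right end.  Conjugating such an element by a small one
   (local transitivity), one gets y such that no generator maps a fixed point of y to a fixed point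
   of y.  For a high power x of y, ping-pong with a neighbourhood of the fixed points of y shows that
   the generators x and x^(n(i+1)) gamma_i x^(n(i+1)) satisfy no relation of length less than n. *)

Set Implicit Arguments.
Unset Strict Implicit.
Unset Printing Implicit Defensive.
Import Order.TTheory GRing.Theory Num.Theory.

Local Open Scope classical_set_scope.
Local Open Scope ring_scope.

(** * Bi-ordered groups *)

(** The order is invariant under conjugation because every map fixes 0. Finiteness of fixed point
    sets also makes commuting rigid: if g commutes with h, and h is nontrivial, then g permutes the
    finitely many fixed points of h in (0,1) monotonically, hence fixes each of them. The obstacle
    to ping-pong is that all elements fix 0 and 1, so it cannot be played on all of I at once. It is
    played between two interior fixed points of y, in a window that widens by one fixed point on
    each side whenever a generator is applied. This is why the intervals must be long, and why one y
    serves only words of bounded length, which is all that girth asks for. The exponents n(i+1) are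
    multiples of n because a word of length less than n contains fewer than n isolated letters x
    between two generators. Since each twisted generator carries the same exponent on both sides,
    the powers meeting between two of them cancel only if the two letters are mutually inverse. *)

Definition zpow (G : groupType) (u : G) (k : int) : G :=
  match k with Posz n => (u ^+ n)%g | Negz n => (u ^- n.+1)%g end.

Lemma zpowS (G : groupType) (u : G) (k : int) : zpow u (k + 1) = (zpow u k * u)%g.
Proof.
case: k => n; first by rewrite -PoszD addn1 /= expgSr.
case: n => [|n]; first by rewrite /= mulVg.
have -> : (Negz n.+1 + 1 = Negz n :> int)%R by lia.
by rewrite [zpow _ (Negz n.+1)]/= expgS invgM mulgVK.
Qed.

Lemma zpowB1 (G : groupType) (u : G) (k : int) : zpow u (k - 1) = (zpow u k / u)%g.
Proof. by rewrite -[k in RHS](subrK 1) zpowS mulgK. Qed.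

Lemma zpowD (G : groupType) (u : G) (k l : int) :
  zpow u (k + l) = (zpow u k * zpow u l)%g.
Proof.
elim: l => [|n IH|n IH]; first by rewrite addr0 mulg1.
- by rewrite -addn1 PoszD addrA !zpowS IH mulgA.
- by rewrite -addn1 PoszD opprD addrA !zpowB1 IH mulgA.
Qed.

Lemma zpowX (G : groupType) (u : G) (k : int) (n : nat) :
  (zpow u k ^+ n)%g = zpow u (k * n%:Z).
Proof.
elim: n => [|n IH]; first by rewrite mulr0.
by rewrite expgSr IH -addn1 PoszD mulrDr mulr1 zpowD.
Qed.

Lemma small_eq0 (R : realType) (c x : R) : (forall m, (0 < m)%N -> m%:R * `|x| <= c) -> x = 0.
Proof.
move=> H; apply/eqP; rewrite -normr_le0 leNgt; apply/negP => x0.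
have c0 : 0 <= c by apply: le_trans (H 1%N isT); rewrite mul1r ltW.
have := archi_boundP (divr_ge0 c0 (ltW x0)); rewrite ltr_pdivrMr// ltNge => /negP; apply.
by case: (Num.bound _) => [|n]; [rewrite mul0r|apply: H].
Qed.

(** * Orders defined by a positive cone *)

Section PositiveCone.
Variables (G : groupType) (P : G -> Prop).
Hypotheses (P1 : ~ P 1%g)
  (PM : forall g h, P g -> P h -> P (g * h)%g)
  (PJ : forall g h, P g -> P (h * g * h^-1)%g)
  (PT : forall g, [\/ g = 1%g, P g | P g^-1%g]).

Definition glt (g h : G) := P (g^-1 * h)%g.
Definition gle (g h : G) := g = h \/ glt g h.

Lemma glt_irr g : ~ glt g g.
Proof. by rewrite /glt mulVg. Qed.

Lemma glt_trans h g k : glt g h -> glt h k -> glt g k.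
Proof. by move=> gh hk; have := PM gh hk; rewrite mulgA mulgK. Qed.

Lemma glt_total g h : [\/ glt g h, g = h | glt h g].
Proof.
case: (PT (g^-1 * h)%g) => [e|p|p].
- by apply: Or32; rewrite -(mulVKg g h) e mulg1.
- exact: Or31.
- by apply: Or33; rewrite invgM invgK in p.
Qed.

Lemma gle_or g h : gle g h \/ glt h g.
Proof. by case: (glt_total g h) => [?|?|?]; [left; right|left; left|right]. Qed.

Lemma gle_refl g : gle g g. Proof. by left. Qed.
Lemma gltW g h : glt g h -> gle g h. Proof. by right. Qed.

Lemma gle_lt_trans h g k : gle g h -> glt h k -> glt g k.
Proof. by move=> [->|]//; exact: glt_trans. Qed.

Lemma glt_le_trans h g k : glt g h -> gle h k -> glt g k.
Proof. by move=> gh [<-|]//; exact: glt_trans. Qed.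

Lemma gle_trans h g k : gle g h -> gle h k -> gle g k.
Proof. by move=> [->//|gh] hk; right; exact: glt_le_trans hk. Qed.

Lemma gltNge g h : glt g h -> ~ gle h g.
Proof. by move=> gh hg; exact: glt_irr (glt_le_trans gh hg). Qed.

Lemma glt_mul2l k g h : glt g h -> glt (k * g)%g (k * h)%g.
Proof. by rewrite /glt invgM mulgA mulgVK. Qed.

Lemma glt_mul2r k g h : glt g h -> glt (g * k)%g (h * k)%g.
Proof.
by move=> gh; rewrite /glt invgM -mulgA [(g^-1 * _)%g]mulgA mulgA -[X in (_ * X)%g]invgK; exact: PJ.
Qed.

Lemma glt_inv g h : glt g h -> glt h^-1%g g^-1%g.
Proof. by move=> /(glt_mul2l g^-1%g)/(glt_mul2r h^-1%g); rewrite mulVg mul1g mulgK. Qed.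

Lemma gle_mul2l k g h : gle g h -> gle (k * g)%g (k * h)%g.
Proof. by move=> [->|?]; [left|right; exact: glt_mul2l]. Qed.

Lemma gle_mul2r k g h : gle g h -> gle (g * k)%g (h * k)%g.
Proof. by move=> [->|?]; [left|right; exact: glt_mul2r]. Qed.

Lemma gle_mul a b c d : gle a b -> gle c d -> gle (a * c)%g (b * d)%g.
Proof. by move=> ab cd; exact: gle_trans (gle_mul2r _ ab) (gle_mul2l _ cd). Qed.

Lemma glt_mul a b c d : glt a b -> glt c d -> glt (a * c)%g (b * d)%g.
Proof. by move=> ab cd; exact: glt_trans (glt_mul2r _ ab) (glt_mul2l _ cd). Qed.

Lemma gle_inv g h : gle g h -> gle h^-1%g g^-1%g.
Proof. by move=> [->|?]; [left|right; exact: glt_inv]. Qed.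

Lemma gle_conj k g h : gle g h -> gle (k * g * k^-1)%g (k * h * k^-1)%g.
Proof. by move=> ?; exact/gle_mul2r/gle_mul2l. Qed.

Lemma gle_pow n g h : gle g h -> gle (g ^+ n)%g (h ^+ n)%g.
Proof. by move=> gh; elim: n => [|n IH]; [left|rewrite !expgS; exact: gle_mul]. Qed.

Lemma glt_pow n g h : (0 < n)%N -> glt g h -> glt (g ^+ n)%g (h ^+ n)%g.
Proof.
move=> + gh; elim: n => // -[|n] IH _ //.
by rewrite [X in glt X _]expgS [X in glt _ X]expgS; apply: glt_mul (IH _).
Qed.

Lemma pos_lt g : P g <-> glt 1%g g.
Proof. by rewrite /glt invg1 mul1g. Qed.

Lemma pos_le_pow g n : P g -> gle 1%g (g ^+ n)%g.
Proof. by move/pos_lt/gltW/(gle_pow n); rewrite expg1n. Qed.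

Lemma pos_pow g n : (0 < n)%N -> P g -> P (g ^+ n)%g.
Proof. by move=> n0 /pos_lt/(glt_pow n0); rewrite expg1n => /(proj2 (pos_lt _)). Qed.

Lemma zpow_lt u k l : P u -> k < l -> glt (zpow u k) (zpow u l).
Proof.
move=> Pu kl; have -> : l = (k + `|l - k|%N%:Z)%R by lia.
rewrite zpowD -[X in glt X]mulg1; apply: glt_mul2l; apply/(proj1 (pos_lt _))/pos_pow => //; lia.
Qed.

Lemma zpow_lt_inv u k l : P u -> glt (zpow u k) (zpow u l) -> k < l.
Proof.
move=> Pu kl; case: (ltgtP k l) => // [lk|e].
- by case: (glt_irr (glt_trans kl (zpow_lt Pu lk))).
- by move: kl; rewrite e => /glt_irr.
Qed.

(** Moving an [h] to the left past a [g] can only increase a product, so the power of [g * h] lies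
    between the two sorted words. This controls powers of a product before commutativity is
    known. *)
Lemma pow_comm_le g h n : gle (g * h)%g (h * g)%g ->
  gle (g ^+ n * h ^+ n)%g ((g * h) ^+ n)%g /\ gle ((g * h) ^+ n)%g (h ^+ n * g ^+ n)%g.
Proof.
move=> gh.
have ghn m : gle (g ^+ m * h)%g (h * g ^+ m)%g.
  elim: m => [|m IH]; first by rewrite expg0 mul1g mulg1; left.
  rewrite expgSr -mulgA; apply: gle_trans (gle_mul2l _ gh) _.
  by rewrite !mulgA; exact: gle_mul2r.
elim: n => [|n [IH1 IH2]]; first by rewrite !expg0 mulg1; split; left.
split.
- rewrite [((g * h) ^+ n.+1)%g]expgS; apply: gle_trans (gle_mul2l _ IH1).
  rewrite expgS -mulgA -mulgA; apply: gle_mul2l.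
  by rewrite expgS !mulgA; apply: gle_mul2r.
- rewrite [((g * h) ^+ n.+1)%g]expgSr; apply: gle_trans (gle_mul2r _ IH2) _.
  rewrite -mulgA (expgSr h) -!mulgA; apply: gle_mul2l.
  by rewrite mulgA -expgSr.
Qed.

Lemma pow_comm_ge g h n : gle (h * g)%g (g * h)%g ->
  gle (h ^+ n * g ^+ n)%g ((g * h) ^+ n)%g /\ gle ((g * h) ^+ n)%g (g ^+ n * h ^+ n)%g.
Proof.
move=> hg.
have hgn m : gle (h ^+ m * g)%g (g * h ^+ m)%g.
  elim: m => [|m IH]; first by rewrite expg0 mul1g mulg1; left.
  rewrite expgSr -mulgA; apply: gle_trans (gle_mul2l _ hg) _.
  by rewrite !mulgA; exact: gle_mul2r.
elim: n => [|n [IH1 IH2]]; first by rewrite !expg0 mulg1; split; left.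
split.
- rewrite [((g * h) ^+ n.+1)%g]expgS; apply: gle_trans (gle_mul2l _ IH1).
  rewrite [(g ^+ n.+1)%g]expgS mulgA; apply: gle_trans (gle_mul2r _ (hgn _)) _.
  by rewrite expgS !mulgA; left.
- rewrite [((g * h) ^+ n.+1)%g]expgSr; apply: gle_trans (gle_mul2r _ IH2) _.
  rewrite (expgSr g) -!mulgA; apply: gle_mul2l.
  by rewrite expgSr !mulgA; exact: gle_mul2r.
Qed.

(** * Hölder's theorem for an Archimedean subgroup *)

Section Hoelder.
Variables (R : realType) (S : G -> Prop) (u : G).
Hypotheses (SM : forall g h, S g -> S h -> S (g * h)%g) (SV : forall g, S g -> S g^-1%g)
  (Su : S u) (Pu : P u)
  (arch : forall g h, S g -> S h -> P g -> exists n, glt h (g ^+ n)%g).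

Lemma S1 : S 1%g.
Proof. by rewrite -(mulVg u); apply: SM => //; exact: SV. Qed.

Lemma SX g n : S g -> S (g ^+ n)%g.
Proof. by move=> Sg; elim: n => [|n IH]; [exact: S1|rewrite expgS; exact: SM]. Qed.

Definition bracket g (k : int) := gle (zpow u k) g /\ glt g (zpow u (k + 1)).

Lemma bracket_ex g : S g -> exists k, bracket g k.
Proof.
move=> Sg; have [n gn] := arch Su Sg Pu; have [m gm] := arch Su (SV Sg) Pu.
have {}gm : gle (zpow u (- m%:Z)) g.
  right; have := glt_inv gm; rewrite invgK; congr glt.
  by case: m {gm} => [|m] //=; rewrite ?invg1.
have {gn} : exists d : nat, glt g (zpow u (- m%:Z + d%:Z)).
  by exists (m + n)%N; have -> : (- m%:Z + (m + n)%N%:Z)%R = n%:Z by lia.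
case=> d; move: (- m%:Z)%R gm => k; elim: d k => [|d IH] k gk.
  by rewrite addr0 => /gltNge.
case: (gle_or (zpow u (k + 1)) g) => [k1|gk1 _]; last by exists k.
have -> : (k + d.+1%:Z)%R = (k + 1 + d%:Z)%R by lia.
exact: IH.
Qed.

Definition floor_pow g n : int := xget 0 [set k | bracket (g ^+ n)%g k].

Lemma floor_powP g n : S g -> bracket (g ^+ n)%g (floor_pow g n).
Proof.
move=> Sg; have [k kP] := bracket_ex (SX n Sg).
by rewrite /floor_pow; case: xgetP => [_ -> //|/(_ k)].
Qed.

(** Both sides bracket [g ^+ (n * m)], read as a power of [g ^+ n] and as a power of [g ^+ m]. Hence
    every lower quotient is below every upper one, so that the supremum [tau] is also bounded from
    above by the upper quotients. *)
Lemma floor_pow_cross g n m : S g -> (0 < n)%N -> (0 < m)%N ->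
  floor_pow g n * m%:Z < n%:Z * (floor_pow g m + 1).
Proof.
move=> Sg n0 m0; apply: (zpow_lt_inv Pu); have [+ _] := floor_powP n Sg; have [_] := floor_powP m Sg.
move=> /(glt_pow n0) A /(gle_pow m) B.
rewrite [n%:Z * _]mulrC -!zpowX; apply: gle_lt_trans B _.
by rewrite -expgnA mulnC expgnA.
Qed.

(* Hoelder's embedding: tau g is the limit of floor_pow g n / n. *)
Definition tau g : R := sup [set (floor_pow g n)%:~R / n%:R | n in [set n : nat | (0 < n)%N]].

Lemma tau_bound g m : S g -> (0 < m)%N ->
  (floor_pow g m)%:~R <= m%:R * tau g <= (floor_pow g m + 1)%:~R.
Proof.
move=> Sg m0; have m0' : 0 < m%:R :> R by rewrite ltr0n.
have ub k : (0 < k)%N -> ubound [set (floor_pow g n)%:~R / n%:R | n in [set n : nat | (0 < n)%N]] ((floor_pow g k + 1)%:~R / k%:R : R).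
  move=> k0 _ [n /= n0 <-].
  rewrite ler_pdivrMr ?ltr0n// mulrAC ler_pdivlMr ?ltr0n//.
  have /ltW := floor_pow_cross Sg n0 k0; rewrite -(ler_int R) !intrM mulrC => A.
  by rewrite mulrC [leRHS]mulrC -!pmulrn in A *.
apply/andP; split.
- rewrite mulrC -ler_pdivrMr//; apply: ub_le_sup; last by exists m.
  by exists ((floor_pow g 1 + 1)%:~R / 1%:R); apply: ub.
- rewrite mulrC -ler_pdivlMr//; apply: ge_sup; last exact: ub.
  by exists ((floor_pow g 1)%:~R / 1%:R); exists 1%N.
Qed.

Lemma tauM g h : S g -> S h -> tau (g * h)%g = tau g + tau h.
Proof.
(* The floors of the m-th powers confine m times the defect of additivity to [-3, 2]; a bound
   independent of m forces the defect to vanish. *)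
move=> Sg Sh; apply/eqP; rewrite -subr_eq0; apply/eqP; apply: (@small_eq0 _ 4) => m m0.
have /andP[a1 a2] := tau_bound Sg m0; have /andP[b1 b2] := tau_bound Sh m0.
have /andP[c1 c2] := tau_bound (SM Sg Sh) m0.
have : (floor_pow g m + floor_pow h m - 1 <= floor_pow (g * h)%g m <= floor_pow g m + floor_pow h m + 1)%R.
  have [A1 A2] := floor_powP m Sg; have [B1 B2] := floor_powP m Sh; have [C1 C2] := floor_powP m (SM Sg Sh).
  have comm k l : (zpow u k * zpow u l)%g = (zpow u l * zpow u k)%g by rewrite -!zpowD addrC.
  have lo : gle (zpow u (floor_pow g m + floor_pow h m)) ((g * h) ^+ m)%g.
    case: (gle_or (g * h)%g (h * g)%g) => [/(pow_comm_le m)[D _]|/gltW/(pow_comm_ge m)[D _]];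
      apply: gle_trans D; last rewrite addrC; rewrite zpowD; exact: gle_mul.
  have hi : glt ((g * h) ^+ m)%g (zpow u (floor_pow g m + 1 + (floor_pow h m + 1))).
    case: (gle_or (g * h)%g (h * g)%g) => [/(pow_comm_le m)[_ D]|/gltW/(pow_comm_ge m)[_ D]];
      apply: gle_lt_trans D _; first rewrite addrC; rewrite zpowD; exact: glt_mul.
  have := zpow_lt_inv Pu (gle_lt_trans lo C2).
  have := zpow_lt_inv Pu (gle_lt_trans C1 hi).
  lia.
move=> /andP[]; rewrite -!(ler_int R) ?(rmorphB, rmorphD)/= => d1 d2.
rewrite rmorphD/= in a2 b2 c2.
rewrite -[m%:R]ger0_norm ?ler0n// -normrM ler_norml; apply/andP; split; nra.
Qed.

Lemma tau_gt0 g : S g -> P g -> 0 < tau g.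
Proof.
move=> Sg Pg; have [n un] := arch Sg Su Pg.
have n0 : (0 < n)%N by case: n un => [|//]; rewrite expg0 => /glt_trans/(_ (proj1 (pos_lt _) Pu))/glt_irr.
have /andP[+ _] := tau_bound Sg n0.
have [_ A] := floor_powP n Sg; have := zpow_lt_inv (k := 1) Pu (glt_trans un A).
rewrite -ltrBlDr subrr -(ltr_int R) => B C; move: (lt_le_trans B C).
by rewrite pmulr_rgt0// ltr0n.
Qed.

Lemma tau1 : tau 1%g = 0.
Proof. by apply: (addrI (tau 1%g)); rewrite -(tauM S1 S1) mulg1 addr0. Qed.

Lemma tauV g : S g -> tau g^-1%g = - tau g.
Proof.
by move=> Sg; apply: (addrI (tau g)); rewrite -(tauM Sg (SV Sg)) mulgV tau1 subrr.
Qed.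

Lemma tau_eq0 g : S g -> tau g = 0 -> g = 1%g.
Proof.
move=> Sg g0; case: (PT g) => // [/(tau_gt0 Sg)|/(tau_gt0 (SV Sg))]; first by rewrite g0 ltxx.
by rewrite tauV// g0 oppr0 ltxx.
Qed.

Lemma tau_inj g h : S g -> S h -> tau g = tau h -> g = h.
Proof.
move=> Sg Sh e; apply: divg1_eq; apply: tau_eq0; first exact: SM Sg (SV Sh).
by rewrite (tauM Sg (SV Sh)) (tauV Sh) e subrr.
Qed.

Lemma S_comm g h : S g -> S h -> (g * h = h * g)%g.
Proof.
move=> Sg Sh; apply: tau_inj; [exact: SM|exact: SM|].
by rewrite (tauM Sg Sh) (tauM Sh Sg) addrC.
Qed.

(** A positive additive function is monotone, so evaluating it on the bracket of [g ^+ m] traps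
    [t g / t u] in the same intervals as [tau g]. With [t] a conjugate of [tau], this produces a
    scaling factor. *)
Lemma tau_unique (t : G -> R) : (forall g h, S g -> S h -> t (g * h)%g = t g + t h) ->
  (forall g, S g -> P g -> 0 < t g) -> forall g, S g -> t g = t u * tau g.
Proof.
move=> tM t0 g Sg; have tu0 := t0 _ Su Pu.
have t1 : t 1%g = 0 by have := tM _ _ S1 S1; rewrite mulg1 => /eqP; rewrite addrC -subr_eq subrr => /eqP.
have tV h : S h -> t h^-1%g = - t h.
  by move=> Sh; apply/eqP; rewrite -addr_eq0 addrC -tM ?mulgV ?t1//; exact: SV.
have tX h n : S h -> t (h ^+ n)%g = n%:R * t h.
  move=> Sh; elim: n => [|n IH]; first by rewrite t1 mul0r.
  by rewrite expgS tM// ?IH -?natr1; [ring|exact: SX].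
have tz k : S (zpow u k) /\ t (zpow u k) = k%:~R * t u.
  case: k => n; first by split; [exact: SX|rewrite tX].
  by split; [apply/SV/SX|rewrite tV ?tX//; [rewrite NegzE mulrNz mulNr|exact: SX]].
have tle a b : S a -> S b -> gle a b -> t a <= t b.
  move=> Sa Sb [->//|]; rewrite /glt => /(t0 _ (SM (SV Sa) Sb)).
  by rewrite tM ?tV//; [rewrite addrC subr_gt0 => /ltW|exact: SV].
rewrite -[LHS](mulVKf (lt0r_neq0 tu0)); congr (_ * _); apply/eqP; rewrite -subr_eq0; apply/eqP.
apply: (@small_eq0 _ 1) => m m0; have /andP[a1 a2] := tau_bound Sg m0.
have [B1 /gltW B2] := floor_powP m Sg; have [Sz tzk] := tz (floor_pow g m); have [Sz1 tzk1] := tz (floor_pow g m + 1).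
have := tle _ _ Sz (SX _ Sg) B1; have := tle _ _ (SX _ Sg) Sz1 B2.
rewrite tzk tzk1 tX// => C1 C2.
have {}C1 : m%:R * (t g / t u) <= (floor_pow g m + 1)%:~R by rewrite mulrA ler_pdivrMr.
have {}C2 : (floor_pow g m)%:~R <= m%:R * (t g / t u) by rewrite mulrA ler_pdivlMr.
rewrite rmorphD/= in a2 C1.
rewrite -[m%:R]ger0_norm ?ler0n// -normrM ler_norml mulrBr [_^-1 * _]mulrC; apply/andP; split; lra.
Qed.

End Hoelder.

(** * Domination and chains of Archimedean classes *)

Definition dom f A := forall n, glt (A ^+ n)%g f /\ glt (A ^- n)%g f.

Lemma domV f A : dom f A -> dom f A^-1%g.
Proof. by move=> fA n; rewrite expVgn invgK; have [] := fA n. Qed.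

Lemma dom_gt0 f A : dom f A -> P f.
Proof. by move=> /(_ 0)[+ _]; rewrite expg0 => /(proj2 (pos_lt _)). Qed.

Lemma dom_le f A B : gle A B -> gle A^-1%g B -> dom f B -> dom f A.
Proof.
move=> AB AB' fB n; have [fn _] := fB n.
split; first exact: gle_lt_trans (gle_pow n AB) fn.
by rewrite -expVgn; exact: gle_lt_trans (gle_pow n AB') fn.
Qed.

Lemma abs_ex A : exists2 B, B = A \/ B = A^-1%g & gle A B /\ gle A^-1%g B.
Proof.
case: (PT A) => [->|/pos_lt p|/pos_lt p].
- by exists 1%g; [left|rewrite invg1; split; left].
- exists A; [by left|split; first exact: gle_refl].
  by right; apply: glt_trans (p); have := glt_inv p; rewrite invg1.
- exists A^-1%g; [by right|split; last exact: gle_refl].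
  by right; apply: glt_trans (p); have := glt_inv p; rewrite invg1 invgK.
Qed.

(** If [M] is the larger of the two absolute values, then [A * B] and its inverse are at most
    [M ^+ 2], whose powers are powers of [M]. *)
Lemma domM f A B : dom f A -> dom f B -> dom f (A * B)%g.
Proof.
move=> fA fB; have [A' eA [A1 A2]] := abs_ex A; have [B' eB [B1 B2]] := abs_ex B.
have fA' : dom f A' by case: eA => ->; last exact: domV.
have fB' : dom f B' by case: eB => ->; last exact: domV.
have [M fM [AM BM]] : exists2 M, dom f M & gle A' M /\ gle B' M.
  case: (gle_or A' B') => [|/gltW] ?; first by exists B' => //; split => //; exact: gle_refl.
  by exists A' => //; split => //; exact: gle_refl.
apply: (@dom_le _ _ (M ^+ 2)%g).
- by rewrite expg2; apply: gle_mul; [exact: gle_trans AM|exact: gle_trans BM].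
- by rewrite invgM expg2; apply: gle_mul; [exact: gle_trans BM|exact: gle_trans AM].
- by move=> n; rewrite -expgnA; exact: fM.
Qed.

Lemma dom1 f : P f -> dom f 1%g.
Proof. by move=> Pf n; rewrite expg1n invg1; split; exact: (proj1 (pos_lt _)) Pf. Qed.

Lemma domX f A n : dom f A -> dom f (A ^+ n)%g.
Proof.
move=> fA; elim: n => [|n IH]; first exact/dom1/dom_gt0/fA.
by rewrite expgS; exact: domM.
Qed.

Lemma dom_trans g f A : dom f g -> dom g A -> dom f A.
Proof.
move=> fg gA n; have [+ _] := fg 1%N; rewrite expg1 => gf; have [A1 A2] := gA n.
by split; [exact: glt_trans A1 gf|exact: glt_trans A2 gf].
Qed.

Lemma glt_conj k g h : glt g h -> glt (k * g * k^-1)%g (k * h * k^-1)%g.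
Proof. by move=> ?; exact/glt_mul2r/glt_mul2l. Qed.

Lemma conjV_pow (k g : G) n : (k * (g ^+ n) * k^-1 = (k * g * k^-1) ^+ n)%g.
Proof. by have := conjXg g k^-1%g n; rewrite !conjgE invgK !mulgA. Qed.

Lemma conjV_inv (k g : G) : ((k * g * k^-1)^-1 = k * g^-1 * k^-1)%g.
Proof. by rewrite !invgM invgK mulgA. Qed.

Lemma domJ k f A : dom f A -> dom (k * f * k^-1)%g (k * A * k^-1)%g.
Proof.
move=> fA n; have [A1 A2] := fA n; rewrite -conjV_pow conjV_inv.
by split; exact: glt_conj.
Qed.

(** Chains above [m] serve to locate a lowest class; chains below [f] ([dominates]) are what the
    construction of alternating elements climbs. *)
Fixpoint dominated_by k m : Prop :=
  if k is k'.+1 then exists f, [/\ P f, dom f m & dominated_by k' f] else True.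

Fixpoint dominates k f : Prop :=
  if k is k'.+1 then exists h, [/\ P h, dom f h & dominates k' h] else True.

Lemma dominated_byJ k m g : dominated_by k m -> dominated_by k (g * m * g^-1)%g.
Proof.
elim: k m => //= k IH m [f [Pf fm fk]]; exists (g * f * g^-1)%g.
by split; [exact: PJ|exact: domJ|exact: IH].
Qed.

Lemma dominates_top j k m : P m -> dominates j m -> dominated_by k m ->
  exists2 f, P f & dominates (k + j) f.
Proof.
elim: k j m => [|k IH] j m Pm mj; first by exists m.
by move=> [f [Pf fm fk]]; rewrite addSnnS; apply: IH fk => //; exists m.
Qed.

End PositiveCone.

(** * Groups acting on the interval *)

(** Continuity is implicit, each map being an increasing bijection of the line. Acting on the line
    spares membership proofs; the action will be the identity outside [0,1], hence the restriction
    to (0,1) in [act_fin]. *)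
Record itv_action (R : realType) (G : groupType) := ItvAction {
  act :> G -> R -> R;
  actM : forall g h x, act (g * h)%g x = act g (act h x);
  act1 : forall x, act 1%g x = x;
  act_homo : forall g x y, x < y -> act g x < act g y;
  act_0 : forall g, act g 0 = 0;
  act_end : forall g, act g 1 = 1;
  act_fin : forall g, g <> 1%g ->
    exists s : seq R, forall x, 0 < x < 1 -> act g x = x -> x \in s }.

Section Action.
Variables (R : realType) (G : groupType) (a : itv_action R G).
Implicit Types (g h A f : G) (x y p q : R).

Lemma actK g x : a g^-1%g (a g x) = x.
Proof. by rewrite -actM mulVg act1. Qed.

Lemma actVK g x : a g (a g^-1%g x) = x.
Proof. by rewrite -actM mulgV act1. Qed.

Lemma act_lt g x y : (a g x < a g y) = (x < y).
Proof.
apply/idP/idP => [|/(act_homo a g)//].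
by move=> /(act_homo a g^-1%g); rewrite !actK.
Qed.

Lemma act_le g x y : (a g x <= a g y) = (x <= y).
Proof. by rewrite !leNgt act_lt. Qed.

Lemma actV_lt g x y : (a g^-1%g x < y) = (x < a g y).
Proof. by rewrite -(act_lt g) actVK. Qed.

Lemma lt_actV g x y : (x < a g^-1%g y) = (a g x < y).
Proof. by rewrite -(act_lt g) actVK. Qed.

Lemma actV_le g x y : (a g^-1%g x <= y) = (x <= a g y).
Proof. by rewrite -(act_le g) actVK. Qed.

Lemma le_actV g x y : (x <= a g^-1%g y) = (a g x <= y).
Proof. by rewrite -(act_le g) actVK. Qed.

Lemma act_gt0 g x : (0 < a g x) = (0 < x).
Proof. by rewrite -[X in X < a _ _](act_0 a g) act_lt. Qed.

Lemma act_lt1 g x : (a g x < 1) = (x < 1).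
Proof. by rewrite -[X in _ < X](act_end a g) act_lt. Qed.

Lemma act_itv g x : (0 < a g x < 1) = (0 < x < 1).
Proof. by rewrite act_gt0 act_lt1. Qed.

Lemma act_inj g : injective (a g).
Proof. by move=> x y /(congr1 (a g^-1%g)); rewrite !actK. Qed.

Lemma actXS g n x : a (g ^+ n.+1)%g x = a g (a (g ^+ n)%g x).
Proof. by rewrite expgS actM. Qed.

Lemma actV_fix g x : a g x = x -> a g^-1%g x = x.
Proof. by move=> e; rewrite -[X in a _ X]e actK. Qed.

Lemma actX_fix g n x : a g x = x -> a (g ^+ n)%g x = x.
Proof. by move=> e; elim: n => [|n IH]; [rewrite act1|rewrite actXS IH]. Qed.

(* The fixed point is the infimum of the points of [u, v] that are not moved to the right. *)
Lemma first_fix g u v : u < v -> u < a g u -> a g v < v ->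
  exists p, [/\ u < p < v, a g p = p & forall x, u <= x < p -> x < a g x].
Proof.
move=> uv gu gv; pose E := [set x | u <= x <= v /\ a g x <= x].
have Ev : E v by split; [rewrite lexx ltW|exact: ltW].
have E0 : E !=set0 by exists v.
have lbE : has_lbound E by exists u => x [/andP[]].
have pv : inf E <= v by exact: ge_inf.
have up : u <= inf E by apply: lb_le_inf => // x [/andP[]].
have H x : u <= x < inf E -> x < a g x.
  move=> /andP[ux xp]; rewrite ltNge; apply/negP => gx.
  have Ex : E x by split=> //; rewrite ux (le_trans (ltW xp)).
  by have := ge_inf lbE Ex; rewrite leNgt xp.
have pE : a g (inf E) = inf E.
  apply/eqP; rewrite eq_le; apply/andP; split; rewrite leNgt; apply/negP => C.
    have pv' : inf E < v.
      by rewrite lt_neqAle pv andbT; apply/eqP => e; move: C; rewrite e ltNge (ltW gv).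
    have /inf_lt : inf E < Num.min v (a g (inf E)) by rewrite lt_min pv'.
    move=> /(_ E0)[x Ex]; rewrite lt_min => /andP[_ xp]; have [_ gx] := Ex.
    have : a g (inf E) <= a g x by rewrite act_le; exact: ge_inf.
    by move=> /(lt_le_trans xp); rewrite ltNge gx.
  have ux : u <= a g (inf E).
    by apply: le_trans (ltW gu) _; rewrite act_le.
  by have := H _ (_ : u <= a g (inf E) < inf E); rewrite ux C act_lt ltNge (ltW C) => /(_ isT).
exists (inf E); split => //; apply/andP; split.
  by rewrite lt_neqAle up andbT; apply/eqP => e; move: gu; rewrite e pE ltxx.
by rewrite lt_neqAle pv andbT; apply/eqP => e; move: gv; rewrite -e pE ltxx.
Qed.

Lemma first_fixV g u v : u < v -> a g u < u -> v < a g v ->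
  exists p, [/\ u < p < v, a g p = p & forall x, u <= x < p -> a g x < x].
Proof.
move=> uv gu gv; have ug : u < a g^-1%g u by rewrite lt_actV.
have gv' : a g^-1%g v < v by rewrite actV_lt.
have [p [uvp gp H]] := first_fix uv ug gv'.
by exists p; split=> // [|x /H]; [rewrite -[X in a _ X]gp actVK|rewrite lt_actV].
Qed.

Lemma sign_const g u v w : (forall x, u <= x <= v -> a g x <> x) -> u <= w <= v ->
  w < a g w -> forall x, u <= x <= v -> x < a g x.
Proof.
move=> H /andP[uw wv] gw x /andP[ux xv]; case: (ltgtP x (a g x)) => // [gx|/esym e]; last first.
  by case: (H x); rewrite ?ux.
exfalso; case: (ltgtP x w) => [xw|wx|e].
- have [p [/andP[xp pw] gp _]] := first_fixV xw gx gw.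
  by case: (H p) => //; rewrite (ltW (le_lt_trans ux xp)) (ltW (lt_le_trans pw wv)).
- have [p [/andP[wp px] gp _]] := first_fix wx gw gx.
  by case: (H p) => //; rewrite (ltW (le_lt_trans uw wp)) (ltW (lt_le_trans px xv)).
- by move: gx; rewrite e => /ltW; rewrite leNgt gw.
Qed.

Lemma iter_escape g u v : u <= v -> (forall x, u <= x <= v -> x < a g x) ->
  exists n, forall m, (n <= m)%N -> v < a (g ^+ m)%g u.
Proof.
move=> uv H; suff [n vn] : exists n, v < a (g ^+ n)%g u.
  exists n; elim=> [|m IH]; first by rewrite leqn0 => /eqP <-.
  rewrite leq_eqVlt => /orP[/eqP <-//|/IH vm]; rewrite actXS.
  by apply: lt_trans (H v _) _; [rewrite uv lexx|rewrite act_lt].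
apply: contrapT => C; pose E := [set a (g ^+ n)%g u | n in [set: nat]].
have Ev : ubound E v.
  by move=> _ [n _ <-]; rewrite leNgt; apply/negP => vn; apply: C; exists n.
have E0 : E !=set0 by exists (a (g ^+ 0)%g u), 0%N.
have hE : has_sup E by split=> //; exists v.
have uE : u <= sup E by apply: sup_upper_bound => //; exists 0%N => //; rewrite act1.
have /H : u <= sup E <= v by rewrite uE ge_sup.
rewrite -actV_lt => /sup_gt-/(_ E0)[_ [n _ <-]]; rewrite actV_lt -actXS ltNge => /negP; apply.
by apply: sup_upper_bound => //; exists n.+1.
Qed.

Lemma iter_escapeV g u v : u <= v -> (forall x, u <= x <= v -> a g x < x) ->
  exists n, forall m, (n <= m)%N -> a (g ^+ m)%g v < u.
Proof.
move=> uv H; have [|n nP] := @iter_escape g^-1%g u v uv.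
  by move=> x /H; rewrite lt_actV.
by exists n => m /nP; rewrite expVgn lt_actV.
Qed.

Lemma iter_gt g x n : x < a g x -> x < a (g ^+ n.+1)%g x.
Proof.
move=> xg; elim: n => [|n IH]; first by rewrite expg1.
by rewrite expgSr actM; apply: lt_trans IH _; rewrite act_lt.
Qed.

Lemma iter_neq g x n : a g x <> x -> a (g ^+ n.+1)%g x <> x.
Proof.
case: (ltgtP (a g x) x) => // gx _ e.
  have := @iter_gt g^-1%g x n; rewrite lt_actV expVgn lt_actV e ltxx.
  by move=> /(_ gx).
by have := iter_gt n gx; rewrite e ltxx.
Qed.

Lemma iter_inj g x : a g x <> x -> injective (fun n => a (g ^+ n)%g x).
Proof.
move=> gx; have H m n : (m < n)%N -> a (g ^+ m)%g x <> a (g ^+ n)%g x.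
  move=> mn; have -> : n = (m + (n - m).-1.+1)%N by lia.
  by rewrite expgnDr actM => /act_inj/esym; exact: iter_neq.
by move=> m n e; case: (ltngtP m n) => // /H; rewrite e.
Qed.

(** The orbit of a point that is moved is strictly monotone, hence infinite. This turns commutation
    with an element of finite fixed point set into a common fixed point. *)
Lemma finite_orbit_fix g x (s : seq R) : (forall n, a (g ^+ n)%g x \in s) -> a g x = x.
Proof.
move=> gs; apply: contrapT => /iter_inj inj.
have : (size [seq a (g ^+ n)%g x | n <- iota 0 (size s).+1] <= size s)%N.
  apply: uniq_leq_size; first by rewrite map_inj_uniq ?iota_uniq.
  by move=> _ /mapP[n _ ->]; exact: gs.
by rewrite size_map size_iota ltnn.
Qed.

(** * The sign of an element near 0 *)

Definition pos g := exists2 d : R, 0 < d & forall x, 0 < x < d -> x < a g x.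

Lemma pos1 : ~ pos 1%g.
Proof.
by move=> [d d0 /(_ (d / 2))]; rewrite act1 ltxx => /(_ _)/notF; apply; apply/andP; split; lra.
Qed.

Lemma posM g h : pos g -> pos h -> pos (g * h)%g.
Proof.
move=> [d d0 dP] [d' d'0 d'P]; exists (Num.min d' (a h^-1%g d)).
  by rewrite lt_min d'0 act_gt0.
move=> x; rewrite lt_min lt_actV => /and3P[x0 xd' xd]; rewrite actM.
by apply: lt_trans (d'P _ _) (dP _ _); rewrite ?x0// act_gt0 x0.
Qed.

Lemma posJ g h : pos g -> pos (h * g * h^-1)%g.
Proof.
move=> [d d0 dP]; exists (a h d); first by rewrite act_gt0.
move=> x /andP[x0 xd]; rewrite !actM -actV_lt; apply: dP.
by rewrite act_gt0 x0 actV_lt.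
Qed.

Lemma lower_bound (s : seq R) : exists d : R, [/\ 0 < d, d <= 1 & forall x, x \in s -> 0 < x -> d <= x].
Proof.
elim: s => [|y s [d [d0 d1 dP]]]; first by exists 1; split.
have [y0|y0] := ltP 0 y.
  exists (Num.min d y); split; [by rewrite lt_min d0|by rewrite ge_min d1|].
  move=> x; rewrite inE ge_min => /orP[/eqP ->|xs] x0; first by rewrite lexx orbT.
  by rewrite dP.
exists d; split=> // x; rewrite inE => /orP[/eqP ->|]; last exact: dP.
by rewrite ltNge y0.
Qed.

(** Below all fixed points in (0,1) the direction of motion is constant, so the one at [d / 2]
    decides. *)
Lemma posT g : [\/ g = 1%g, pos g | pos g^-1%g].
Proof.
case: (pselect (g = 1%g)) => [|/(act_fin a)[s sP]]; first exact: Or31.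
have [d [d0 d1 dP]] := lower_bound s.
have nofix x : 0 < x < d -> a g x <> x.
  move=> /andP[x0 xd] gx; have := dP x (sP x _ gx) x0; rewrite x0 (lt_le_trans xd d1) leNgt xd.
  by move=> /(_ isT).
have H h : (forall x, 0 < x < d -> a h x <> x) -> d / 2 < a h (d / 2) -> pos h.
  move=> hx hd; exists d => // x /andP[x0 xd].
  apply: (@sign_const h (Num.min x (d / 2)) (Num.max x (d / 2)) (d / 2)) => //.
  - move=> y /andP[]; rewrite ge_min le_max => y1 y2; apply: hx; apply/andP; split.
      by case/orP: y1 => ?; lra.
    by case/orP: y2 => ?; lra.
  - by rewrite ge_min le_max lexx !orbT.
  - by rewrite ge_min le_max lexx.
case: (ltgtP (d / 2) (a g (d / 2))) => hd.
- exact/Or32/H.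
- apply: Or33; apply: H; last by rewrite lt_actV.
  by move=> x /nofix gx /(congr1 (a g)); rewrite actVK => /esym.
- by case: (nofix (d / 2)) => //; apply/andP; split; lra.
Qed.

Lemma pos_inv_near g : pos g^-1%g -> exists2 d : R, 0 < d & forall x, 0 < x < d -> a g x < x.
Proof. by move=> [d d0 dP]; exists d => // x /dP; rewrite lt_actV. Qed.

Lemma small_point (l : seq G) (w : R) : 0 < w -> exists2 t, 0 < t & {in l, forall g, a g t <= w}.
Proof.
move=> w0; elim: l => [|g l [t t0 tP]]; first by exists 1.
exists (Num.min t (a g^-1%g w)); first by rewrite lt_min t0 act_gt0.
move=> h; rewrite inE => /orP[/eqP ->|hl].
  by rewrite -le_actV ge_min lexx orbT.
by apply: le_trans (tP h hl); rewrite act_le ge_min lexx.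
Qed.

(** * Elements of alternating direction on long intervals *)

Definition moves g (b : bool) x := if b then x < a g x else a g x < x.

(* The intervals are long relative to l: no g in l moves u i beyond v i. *)
Definition alternating A (l : seq G) k b (u v : nat -> R) := forall i, (i < k)%N ->
  [/\ 0 < u i, v i < 1, {in l, forall g, a g (u i) <= v i}, ((i.+1 < k)%N -> v i < u i.+1) &
    forall x, u i <= x <= v i -> moves A (odd i (+) b) x].

Lemma escape_uniform A l k b u v : 1%g \in l -> alternating A l k b u v ->
  exists n, forall i, (i < k)%N -> if odd i (+) b then v i < a (A ^+ n)%g (u i) else a (A ^+ n)%g (v i) < u i.
Proof.
move=> l1 alt.
suff : forall j, (j <= k)%N -> exists n, forall m, (n <= m)%N -> forall i, (i < j)%N ->
    if odd i (+) b then v i < a (A ^+ m)%g (u i) else a (A ^+ m)%g (v i) < u i.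
  by move=> /(_ k (leqnn k))[n nP]; exists n; exact: nP.
elim=> [|j IH] jk; first by exists 0%N.
have [n nP] := IH (ltnW jk); have [_ _ /(_ _ l1) + _ mv] := alt j jk; rewrite act1 => uv.
have [n' n'P] : exists n', forall m, (n' <= m)%N ->
    if odd j (+) b then v j < a (A ^+ m)%g (u j) else a (A ^+ m)%g (v j) < u j.
  by case: (odd j (+) b) mv => mv; [exact: iter_escape|exact: iter_escapeV].
exists (maxn n n') => m; rewrite geq_max => /andP[nm n'm] i.
by rewrite ltnS leq_eqVlt => /orP[/eqP ->|ij]; [exact: n'P|exact: nP].
Qed.

(** The intervals will be shrunk by translates under [e = f] or [f^-1]. To stay long they need
    [g (e' u) <= e^-1 v], that is, [e g e' u <= v] for the old ends. *)
Definition enlarge f (l : seq G) :=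
  let E := [:: 1%g; f; f^-1%g] in [seq (h * e)%g | h <- [seq (e * g)%g | e <- E, g <- l], e <- E].

Lemma enlarge_in f l e g e' : e \in [:: 1%g; f; f^-1%g] -> e' \in [:: 1%g; f; f^-1%g] -> g \in l ->
  (e * g * e')%g \in enlarge f l.
Proof. by move=> eE eE' gl; apply: allpairs_f => //; exact: allpairs_f. Qed.

(* Near 0, A ^ n f behaves as f, which gives a new interval there; on the old intervals, a large
   power of A outweighs f. *)
Lemma alternating_step A f l k b u v : dom pos f A -> 1%g \in l ->
  alternating A (enlarge f l) k.+1 b u v ->
  exists n u' v', alternating (A ^+ n * (if b then f^-1 else f))%g l k.+2 (~~ b) u' v'.
Proof.
(* Near 0 the product has the sign of [e], chosen so that the new interval is moved opposite to the
   first old one. *)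
move=> fA l1 alt; set e := if b then _ else _.
have e1 : e \in [:: 1%g; f; f^-1%g] by rewrite /e !inE; case: b {alt e}; rewrite eqxx ?orbT.
have e2 : e^-1%g \in [:: 1%g; f; f^-1%g] by rewrite /e !inE; case: b {alt e e1}; rewrite ?invgK eqxx ?orbT.
have e0 : 1%g \in [:: 1%g; f; f^-1%g] by rewrite !inE eqxx.
have l1' : 1%g \in enlarge f l by have := enlarge_in e0 e0 l1; rewrite !mul1g.
have [n nP] := escape_uniform l1' alt; set B := (A ^+ n * e)%g.
have [d d0 dP] : exists2 d : R, 0 < d & forall x, 0 < x < d -> moves B (~~ b) x.
  have [A1 A2] := fA n; rewrite /B /e; case: b {alt e e1 e2 nP B} => /=.
    apply: pos_inv_near; rewrite invgM invgK.
    by have := posJ f A1; rewrite mulgA mulgK.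
  by move: A2; rewrite /glt invgK.
pose u1 i := Num.max (u i) (a e^-1%g (u i)); pose v1 i := Num.min (v i) (a e^-1%g (v i)).
have u10 : 0 < u1 0%N by rewrite lt_max; have [->] := alt 0%N isT.
pose w := Num.min (Num.min d (u1 0%N)) 1 / 2.
have w0 : 0 < w by rewrite divr_gt0// !lt_min d0 u10 ltr01.
have [wd wu w1] : [/\ w < d, w < u1 0%N & w < 1].
  have : Num.min (Num.min d (u1 0%N)) 1 <= Num.min (Num.min d (u1 0%N)) 1 by [].
  by rewrite {2}/Order.min !le_min => /andP[/andP[]]; rewrite /w in w0 *; split; lra.
have [t t0 tP] := small_point l w0.
have tw : t <= w by have := tP _ l1; rewrite act1.
exists n, (fun i => if i is j.+1 then u1 j else t), (fun i => if i is j.+1 then v1 j else w).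
move=> [|i] ik.
  by split=> // x /andP[x0 xw]; apply: dP; rewrite (lt_le_trans t0 x0) (le_lt_trans xw wd).
have {}ik : (i < k.+1)%N by [].
have [ui vi lP vu mv] := alt i ik; split.
- by rewrite lt_max ui.
- by rewrite gt_min vi.
- move=> g gl; rewrite /u1 /v1.
  have H h h' : h \in [:: 1%g; e] -> h' \in [:: 1%g; e^-1]%g -> a g (a h' (u i)) <= a h^-1%g (v i).
    move=> hE hE'; rewrite le_actV -!actM; apply: lP; apply: enlarge_in => //.
      by move: hE; rewrite in_cons mem_seq1 => /orP[]/eqP ->.
    by move: hE'; rewrite in_cons mem_seq1 => /orP[]/eqP ->.
  have m1 : 1%g \in [:: 1%g; e] by exact: mem_head.
  have m2 : e \in [:: 1%g; e] by rewrite in_cons mem_head orbT.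
  have n1 : 1%g \in [:: 1%g; e^-1%g] by exact: mem_head.
  have n2 : e^-1%g \in [:: 1%g; e^-1%g] by rewrite in_cons mem_head orbT.
  have H1 := H _ _ m1 n1; have H2 := H _ _ m1 n2; have H3 := H _ _ m2 n1; have H4 := H _ _ m2 n2.
  rewrite invg1 !act1 in H1 H2 H3; rewrite le_min.
  have [->|->] : Num.max (u i) (a e^-1%g (u i)) = u i \/ Num.max (u i) (a e^-1%g (u i)) = a e^-1%g (u i).
    by case: (leP (u i) _); [right|left].
  - by apply/andP.
  - by apply/andP.
- by move=> /vu vu'; rewrite lt_max gt_min vu'.
- move=> x; rewrite /u1 /v1 ge_max le_min => /andP[/andP[ux ux'] /andP[xv xv']].
  have {}xv' : a e x <= v i by rewrite -le_actV.
  have {}ux' : u i <= a e x by rewrite -actV_le.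
  rewrite /moves /B actM /= addNb -addbN negbK.
  have := nP i ik; case: ifP => _ H.
    by apply: le_lt_trans xv _; apply: lt_le_trans H _; rewrite act_le.
  by apply: lt_le_trans ux; apply: le_lt_trans H; rewrite act_le.
Qed.

(** Induction along the chain below [f]. The domination clause lets the next element up the chain
    dominate [A]; [l] is general because each step asks for intervals that are long relative to an
    enlarged list. *)
Lemma alternating_ex k f l : pos f -> dominates pos k f -> 1%g \in l ->
  exists A b u v, (forall f', dom pos f' f -> dom pos f' A) /\ alternating A l k.+1 b u v.
Proof.
elim: k f l => [|k IH] f l Pf.
  move=> _ l1; have [d d0 dP] := Pf; pose w := Num.min d 1 / 2.
  have w0 : 0 < w by rewrite divr_gt0// lt_min d0 ltr01.
  have [wd w1] : w < d /\ w < 1.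
    have : Num.min d 1 <= Num.min d 1 by [].
    by rewrite {2}/Order.min le_min => /andP[]; rewrite /w in w0 *; split; lra.
  have [t t0 tP] := small_point l w0.
  exists f, true, (fun=> t), (fun=> w); split=> // -[|//] _; split=> // x /andP[tx xw].
  by apply: dP; rewrite (lt_le_trans t0 tx) (le_lt_trans xw wd).
move=> [h [Ph fh hk]] l1; have e0 : 1%g \in [:: 1%g; f; f^-1%g] by rewrite !inE eqxx.
have l1' : 1%g \in enlarge f l by have := enlarge_in e0 e0 l1; rewrite !mul1g.
have [A [b [u [v [Adom alt]]]]] := IH h _ Ph hk l1'.
have [n [u' [v' alt']]] := alternating_step (Adom _ fh) l1 alt.
exists (A ^+ n * (if b then f^-1 else f))%g, (~~ b), u', v'; split=> // f' f'f.
have H := domM posM posJ posT; apply: H; last by case: b {alt alt'} => //; exact: domV.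
by apply: domX => //; [exact: posM|exact: posJ|exact: posT|apply: Adom; apply: dom_trans fh => //; exact: posM].
Qed.

End Action.

(** * The affine case *)

Definition affine_embedding (R : realType) (G : groupType) (rho b : G -> R) := [/\ forall g, 0 < rho g,
  forall g h, rho (g * h)%g = rho g * rho h,
  forall g h, b (g * h)%g = b g + rho g * b h &
  forall g, rho g = 1 -> b g = 0 -> g = 1%g].

Section Affine.
Variables (R : realType) (G : groupType) (a : itv_action R G).
Hypothesis irr : forall p, 0 < p < 1 -> exists g, a g p <> p.
Let PM := @posM _ _ a.
Let PJ := @posJ _ _ a.
Let PT := @posT _ _ a.
Let P1 := @pos1 _ _ a.

Variables (m : G) (k : nat).
Hypotheses (Pm : pos a m) (mk : dominated_by (pos a) k m)
  (kmax : forall h, pos a h -> ~ dominated_by (pos a) k.+1 h).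

Let le := gle (pos a).
Let lt := glt (pos a).

Lemma not_dom f h : pos a f -> pos a h -> ~ dom (pos a) f h -> exists n, le f (h ^+ n)%g.
Proof.
move=> Pf Ph fh; apply: contrapT => fh'; apply: fh => n; split.
  by case: (gle_or PT f (h ^+ n)%g) => // ?; case: fh'; exists n.
apply: (gle_lt_trans PM) ((pos_lt _ f).1 Pf).
have := gle_inv PJ (pos_le_pow PM PJ n Ph); rewrite invg1; exact.
Qed.

(** Otherwise [m] would lengthen the chain above it to a chain of length [k + 1] above [h]: the
    class of [m] is the lowest. *)
Lemma m_arch h : pos a h -> exists n, le m (h ^+ n)%g.
Proof.
by move=> Ph; apply: not_dom => // mh; apply: (kmax Ph); exists m.
Qed.

(** The chain above [m], conjugated by [g], lies above the conjugate of [m]; if the latter dominated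
    [m], the chain would be too long. This makes the class of [m] normal. *)
Lemma m_conj g : exists n, le (g * m * g^-1)%g (m ^+ n)%g.
Proof.
apply: not_dom => //; first exact: PJ.
move=> gm; apply: (kmax Pm); exists (g * m * g^-1)%g; split=> //; first exact: PJ.
exact: (dominated_byJ PJ).
Qed.

Definition arch_class g := exists n, le g (m ^+ n)%g /\ le g^-1%g (m ^+ n)%g.

Lemma arch_classV g : arch_class g -> arch_class g^-1%g.
Proof. by move=> [n [n1 n2]]; exists n; rewrite invgK. Qed.

Lemma arch_classM g h : arch_class g -> arch_class h -> arch_class (g * h)%g.
Proof.
move=> [n [n1 n2]] [n' [n1' n2']]; exists (n + n')%N; split.
  by rewrite expgnDr; exact: (gle_mul PM PJ).
by rewrite invgM addnC expgnDr; exact: (gle_mul PM PJ).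
Qed.

Lemma arch_class_base : arch_class m.
Proof.
exists 1%N; rewrite expg1; split; first exact: gle_refl.
apply: (gle_trans PM _ (gltW ((pos_lt _ m).1 Pm))).
by have := gle_inv PJ (gltW ((pos_lt _ m).1 Pm)); rewrite invg1.
Qed.

Lemma arch_classJ g h : arch_class h -> arch_class (g * h * g^-1)%g.
Proof.
have H h' n n' : le (g * m * g^-1)%g (m ^+ n)%g -> le h' (m ^+ n')%g -> le (g * h' * g^-1)%g (m ^+ (n * n'))%g.
  move=> gn /(gle_conj PJ g)/(gle_trans PM); apply; rewrite conjV_pow expgnA.
  exact: (gle_pow PM PJ).
move=> [n [n1 n2]]; have [n' gn'] := m_conj g; exists (n' * n)%N; split; first exact: H.
by rewrite conjV_inv; exact: H.
Qed.

Lemma arch_class_arch g h : arch_class g -> arch_class h -> pos a g -> exists n, lt h (g ^+ n)%g.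
Proof.
move=> _ [j [hj _]] Pg; have [n mn] := m_arch Pg; exists (n * j).+1.
apply: (gle_lt_trans PM hj); rewrite expgSr expgnA.
apply: (gle_lt_trans PM (gle_pow PM PJ j mn)).
by rewrite -[X in glt _ X]mulg1; apply: glt_mul2l; exact/(pos_lt _ g).1.
Qed.

Lemma arch_class_comm g h : arch_class g -> arch_class h -> (g * h = h * g)%g.
Proof.
exact: (@S_comm _ _ P1 PM PJ PT R arch_class m arch_classM arch_classV arch_class_base Pm arch_class_arch).
Qed.

(** The class of [m] commutes with [m], so all of it would fix [p]. Being normal, it contains the
    conjugates of [m], so [m] would fix the whole orbit of [p]; all orbits being finite, [p] would
    be a global fixed point. *)
Lemma m_free p : 0 < p < 1 -> a m p <> p.
Proof.
move=> p01 mp; have m1 : m <> 1%g by move=> e; apply: P1; rewrite -e.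
have [s sP] := act_fin a m1.
have fixp h : arch_class h -> a h p = p.
  move=> Ah; apply: (@finite_orbit_fix _ _ a h p s) => n; apply: sP; first by rewrite act_itv.
  have hn : arch_class (h ^+ n)%g.
    elim: n => [|n IH]; last by rewrite expgS; exact: arch_classM.
    by rewrite expg0 -(mulVg m); apply: arch_classM; [exact/arch_classV/arch_class_base|exact: arch_class_base].
  by rewrite -actM (arch_class_comm arch_class_base hn) actM mp.
have [g] := irr p01; apply; apply: (@finite_orbit_fix _ _ a g p s) => n.
apply: sP; first by rewrite act_itv.
have := fixp _ (arch_classJ (g ^- n)%g arch_class_base); rewrite invgK !actM => {2}<-.
by rewrite actVK.
Qed.

(** This will be the kernel of [conj_scale], the part that becomes translations. *)
Definition arch_cent c := forall g, arch_class g -> (c * g = g * c)%g.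

Lemma arch_centM g h : arch_cent g -> arch_cent h -> arch_cent (g * h)%g.
Proof. by move=> Cg Ch x Ax; rewrite -mulgA Ch// !mulgA Cg. Qed.

Lemma arch_centV g : arch_cent g -> arch_cent g^-1%g.
Proof. by move=> Cg x Ax; apply: (mulgI g); rewrite mulVKg mulgA Cg// mulgK. Qed.

Lemma arch_class_cent g : arch_class g -> arch_cent g.
Proof. by move=> Ag x Ax; exact: arch_class_comm. Qed.

Lemma arch_centJ g c : arch_cent c -> arch_cent (g * c * g^-1)%g.
Proof.
move=> Cc x Ax; have := Cc _ (arch_classJ g^-1%g Ax); rewrite invgK => e.
by apply: (mulgI g^-1%g); rewrite !mulgA mulVg mul1g; apply: (mulIg g); rewrite -!mulgA mulVg mulg1 !mulgA in e *.
Qed.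

(** The fixed points of [c] in (0,1) form a finite set preserved by [m], which moves every point. *)
Lemma arch_cent_free c p : arch_cent c -> c <> 1%g -> 0 < p < 1 -> a c p <> p.
Proof.
move=> Cc /(act_fin a)[s sP] p01 cp; apply: (m_free p01); apply: (@finite_orbit_fix _ _ a m p s) => n.
apply: sP; first by rewrite act_itv.
suff e : (c * m ^+ n = m ^+ n * c)%g by rewrite -actM e actM cp.
apply: Cc; elim: n => [|n IH]; last by rewrite expgS; apply: arch_classM IH; exact: arch_class_base.
by rewrite expg0 -(mulVg m); apply: arch_classM; [exact/arch_classV/arch_class_base|exact: arch_class_base].
Qed.

Lemma arch_cent_right c p : arch_cent c -> pos a c -> 0 < p < 1 -> p < a c p.
Proof.
move=> Cc Pc p01; have [d d0 dP] := Pc; pose w := Num.min d p / 2.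
have /andP[p0 p1] := p01.
have w0 : 0 < w by rewrite divr_gt0// lt_min d0.
have [wd wp] : w < d /\ w < p.
  have : Num.min d p <= Num.min d p by [].
  by rewrite {2}/Order.min le_min => /andP[]; rewrite /w in w0 *; split; lra.
apply: (@sign_const _ _ a c w p w); rewrite ?lexx ?ltW//; last by apply: dP; rewrite w0.
move=> x /andP[wx xp]; apply: arch_cent_free => //; last by rewrite (lt_le_trans w0 wx) (le_lt_trans xp).
by move=> e; apply: P1; rewrite -e.
Qed.

(** In a freely acting group, elements compare near 0 as they do at 1/2, and the iterates of [g]
    push 1/2 beyond its image under [h]. *)
Lemma arch_cent_arch g h : arch_cent g -> arch_cent h -> pos a g -> exists n, lt h (g ^+ n)%g.
Proof.
move=> Cg Ch Pg; pose v := Num.max 2^-1 (a h 2^-1).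
have h01 : 0 < (2^-1 : R) < 1 by apply/andP; split; lra.
have v01 : 2^-1 <= v < 1 by rewrite le_max lexx gt_max act_lt1; lra.
have /andP[v0 v1] := v01.
have [|n nP] := @iter_escape _ _ a g 2^-1 v v0.
  by move=> x /andP[x0 xv]; apply: arch_cent_right => //; apply/andP; split; lra.
exists n; have hn : 2^-1 < a (h^-1 * g ^+ n)%g 2^-1.
  by rewrite actM lt_actV; apply: le_lt_trans (nP n (leqnn n)); rewrite /v le_max lexx orbT.
have Cn : arch_cent (g ^+ n)%g.
  elim: n {nP hn} => [|n IH]; last by rewrite expgS; exact: arch_centM.
  by rewrite expg0 -(mulVg g); apply: arch_centM => //; exact: arch_centV.
have CH : arch_cent (h^-1 * g ^+ n)%g by apply: arch_centM => //; exact: arch_centV.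
case: (PT (h^-1 * g ^+ n)%g) => // [e|/(arch_cent_right (arch_centV CH))/(_ h01)].
  by move: hn; rewrite e act1 ltxx.
by rewrite lt_actV ltNge ltW.
Qed.

Let t := @tau _ (pos a) R m.
Let tM := @tauM _ _ P1 PM PJ PT R arch_cent m arch_centM arch_centV (arch_class_cent arch_class_base) Pm arch_cent_arch.
Let t_gt0 := @tau_gt0 _ _ P1 PM PJ PT R arch_cent m arch_centM arch_centV (arch_class_cent arch_class_base) Pm arch_cent_arch.
Let t_eq0 := @tau_eq0 _ _ P1 PM PJ PT R arch_cent m arch_centM arch_centV (arch_class_cent arch_class_base) Pm arch_cent_arch.
Let t_inj := @tau_inj _ _ P1 PM PJ PT R arch_cent m arch_centM arch_centV (arch_class_cent arch_class_base) Pm arch_cent_arch.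
Let t_unique := @tau_unique _ _ P1 PM PJ PT R arch_cent m arch_centM arch_centV (arch_class_cent arch_class_base) Pm arch_cent_arch.

(** The factor by which conjugation by [g] multiplies [t], read off at [m], where [t] is 1. *)
Definition conj_scale g := t (g * m * g^-1)%g.

Lemma tau_conj g c : arch_cent c -> t (g * c * g^-1)%g = conj_scale g * t c.
Proof.
move=> Cc; apply: (@t_unique (fun c => t (g * c * g^-1)%g)) => // [x y Cx Cy|x Cx Px].
  by rewrite -tM; [rewrite !mulgA mulgVK|exact: arch_centJ|exact: arch_centJ].
by apply: t_gt0; [exact: arch_centJ|exact: PJ].
Qed.

Lemma tm1 : t m = 1.
Proof.
have Cm := arch_class_cent arch_class_base; have := t_unique tM t_gt0 Cm.
rewrite -[LHS]mulr1 => /mulfI H; apply/esym/H; exact/lt0r_neq0/t_gt0.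
Qed.

Lemma conj_scale_gt0 g : 0 < conj_scale g.
Proof. by apply: t_gt0; [exact/arch_centJ/arch_class_cent/arch_class_base|exact: PJ]. Qed.

Lemma conj_scaleM g h : conj_scale (g * h)%g = conj_scale g * conj_scale h.
Proof.
rewrite -tau_conj; last exact/arch_centJ/arch_class_cent/arch_class_base.
by rewrite /conj_scale invgM !mulgA.
Qed.

Lemma conj_scale1 g : arch_cent g -> conj_scale g = 1.
Proof. by move=> Cg; rewrite /conj_scale Cg ?mulgK ?tm1//; exact: arch_class_base. Qed.

Lemma conj_scale_cent g : conj_scale g = 1 -> arch_cent g.
Proof.
move=> g1 x Ax; have := tau_conj g (arch_class_cent Ax); rewrite g1 mul1r.
by move/(t_inj (arch_centJ g (arch_class_cent Ax)) (arch_class_cent Ax)) => {2}<-; rewrite mulgVK.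
Qed.

Lemma conj_scaleV g : conj_scale g * conj_scale g^-1%g = 1.
Proof. by rewrite -conj_scaleM mulgV; apply/conj_scale1 => x _; rewrite mul1g mulg1. Qed.

Lemma affine_ex : exists rho b : G -> R, affine_embedding rho b.
Proof.
have [r1|] := pselect (forall g, conj_scale g = 1).
  exists conj_scale, t; split=> [|||g _ /t_eq0->//]; [exact: conj_scale_gt0|exact: conj_scaleM| |exact/conj_scale_cent/r1].
  by move=> g h; rewrite r1 mul1r; apply: tM; exact/conj_scale_cent/r1.
(* In coordinates where [f] is x -> r x, its commutator with x -> s x + b is the translation by (r -
   1) b. Hence the translation part of [g] is [t (c g)] divided by [conj_scale f - 1]. *)
move=> /existsNP[f fr]; pose c g := (f * g * f^-1 * g^-1)%g.
have Cc g : arch_cent (c g).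
  by apply: conj_scale_cent; rewrite /c !conj_scaleM [X in X * _]mulrAC conj_scaleV mul1r conj_scaleV.
have cM g h : c (g * h)%g = (c g * (g * c h * g^-1))%g.
  by rewrite /c invgM !mulgA !mulgVK.
have f1 : conj_scale f - 1 != 0 by rewrite subr_eq0; apply/eqP.
exists conj_scale, (fun g => t (c g) / (conj_scale f - 1)); split.
- exact: conj_scale_gt0.
- exact: conj_scaleM.
- move=> g h; have /(congr1 (fun x => x / (conj_scale f - 1))) := tM (Cc g) (arch_centJ g (Cc h)).
  by rewrite -cM mulrDl [X in (_ = _ + X / _) -> _](tau_conj g (Cc h)) -mulrA.
(* Such a [g] commutes with [f], while conjugation by [f] multiplies [t g] by a factor other than 1;
   so [t g] is 0. *)
move=> g /conj_scale_cent Cg /eqP; rewrite mulf_eq0 invr_eq0 (negPf f1) orbF => /eqP /(t_eq0 (Cc g)).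
move=> /divg1_eq e; have := tau_conj f Cg; rewrite e => /eqP.
rewrite eq_sym -subr_eq0 -[X in _ - X]mul1r -mulrBl mulf_eq0 (negPf f1) => /eqP.
exact: t_eq0.
Qed.

End Affine.

(** * Ping-pong *)

Lemma zpow1 (G : groupType) (u : G) : zpow u 1 = u.
Proof. by rewrite /= expg1. Qed.

Lemma zpowN (G : groupType) (u : G) (k : int) : zpow u (- k) = (zpow u k)^-1%g.
Proof.
by apply: (mulgI (zpow u k)); rewrite -zpowD subrr mulgV.
Qed.

Lemma mulDn_neq0 (n : nat) (c r : int) : (`|r| < n)%N -> c != 0 -> n%:Z * c + r != 0.
Proof.
move=> rn c0; apply/eqP => /eqP; rewrite addr_eq0 => /eqP /(congr1 absz).
rewrite abszN abszM /= => e; move: rn; rewrite -e ltnNge leq_pmulr//; lia.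
Qed.

Section PingPong.
Variables (R : realType) (G : groupType) (a : itv_action R G).
Variables (x : G) (gs : seq G) (n : nat).

(** Indices start at 1, so that [- b] names the inverse letter. Letters [b] and [b'] separated by
    the r-th power of [x] meet in the exponent n (b + b') + r; when |r| < n it vanishes only for b'
    = - b and r = 0. *)
Definition twisted (b : int) : G :=
  (zpow x (n%:Z * b) * zpow (nth 1%g gs `|b|%N.-1) (sgz b) * zpow x (n%:Z * b))%g.

Lemma twistedN b : twisted (- b) = (twisted b)^-1%g.
Proof. by rewrite /twisted abszN sgzN mulrN !zpowN !invgM mulgA. Qed.

Definition letter (t : G) := (exists2 d : int, `|d|%N = 1%N & t = zpow x d) \/
  (exists2 b : int, (0 < `|b| <= size gs)%N & t = twisted b).

Variables (V W : nat -> R -> Prop) (z : R).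
Hypotheses (Vz : V 0 z) (Wz : forall N, ~ W N z)
  (VW : forall N v k, (N <= n)%N -> V N v -> k != 0 -> W N (a (zpow x k) v))
  (WV : forall N v g, (N < n)%N -> W N v -> g \in gs \/ g^-1%g \in gs -> V N.+1 (a g v)).

(** An index just past those of the letters: the power of [x] by which words are conjugated is then
    cancelled by no twisted letter. *)
Let E : int := n%:Z * (size gs).+1%:Z.

(* The last letter used determines the exponent of x still to be applied: it is n b + r, and r is
   nonzero as soon as that letter is a power of x. *)
Lemma pingpong_inv w : (forall t, t \in w -> letter t) -> sorted (fun s t => s * t != 1)%g w ->
  (size w < n)%N ->
  exists N v (b r : int), [/\ (N <= size w)%N, V N v,
    a (\prod_(t <- w) t)%g (a (zpow x (- E)) z) = a (zpow x (n%:Z * b + r)) v,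
    (`|r| <= size w)%N &
    match w with
    | [::] => b = - (size gs).+1%:Z /\ r = 0
    | t :: _ => (exists2 d : int, `|d|%N = 1%N /\ t = zpow x d & 
                   0 < r * d /\ ((0 < `|b| <= size gs)%N \/ b = - (size gs).+1%:Z))
             \/ [/\ r = 0, (0 < `|b| <= size gs)%N & t = twisted b]
    end].
Proof.
elim: w => [|t w IH] lw sw wn.
  exists 0%N, z, (- (size gs).+1%:Z), 0; split=> //.
  by rewrite big_nil act1 mulrN addr0.
have {IH} := IH _ (path_sorted sw) (ltnW wn).
have lw' s : s \in w -> letter s by move=> sw'; apply: lw; rewrite inE sw' orbT.
move=> /(_ lw')[N [v [b [r [Nw Vv ev rw H]]]]].
have head : match w with [::] => True | s :: _ => (t * s)%g != 1%g end.
  by case: (w) sw => //= s w' /andP[].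
case: (lw t (mem_head _ _)) => [[d d1 td]|[b' b'gs tb']].
  exists N, v, b, (r + d); split=> //; first by exact: leq_trans Nw _.
  - by rewrite big_cons actM ev -actM td -zpowD; congr (a (zpow x _) v); ring.
  - by move: rw d1; rewrite /=; clear; lia.
  - left; exists d => //.
    case: w rw H head {sw wn lw lw' Nw ev} => [|s w] rw.
      by move=> [-> ->] _; split; [nia|right].
    move=> [[d' [d'1 ->] [rd' bP]]|[-> bP ->]] head; last by split; [nia|left].
    (* In a reduced word, adjacent letters from x and its inverse agree, so [r] keeps its sign and
       grows in absolute value. *)
    split=> //; suff -> : d = d' by move: rd' d'1; clear; nia.
    move: head; rewrite td -zpowD; case: (eqVneq (d + d') 0) => [->|]; [by rewrite eqxx|move: d1 d'1; clear; lia].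
(* If [b + b'] vanishes, then [b] is a genuine index, so the preceding letter is a power of [x] and
   [r] is nonzero, or it is the inverse of [t], which reducedness excludes. *)
have tot : n%:Z * (b + b') + r != 0.
  have [bb|bb] := eqVneq (b + b') 0; last exact: mulDn_neq0 (leq_ltn_trans rw (ltnW wn)) bb.
  rewrite bb mulr0 add0r; apply/eqP => r0; have eb : b = - b' by lia.
  case: w rw H head {sw wn lw lw' Nw ev} => [|s w] rw.
    by move=> [+ _] _; lia.
  move=> [[d' _ []]|[_ _ ->]]; first by rewrite r0 mul0r.
  by rewrite eb tb' twistedN mulgV eqxx.
have WW := VW (leq_trans Nw (ltnW (ltnW wn))) Vv tot.
exists N.+1, (a (zpow (nth 1%g gs `|b'|%N.-1) (sgz b')) (a (zpow x (n%:Z * (b + b') + r)) v)), b', 0.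
split=> //.
- apply: WV WW _; first by exact: leq_ltn_trans Nw (ltnW wn).
  have m : nth 1%g gs `|b'|%N.-1 \in gs by apply: mem_nth; case/andP: b'gs => b'0; rewrite prednK.
  by case: (sgzP b') => // hb; [lia|left; rewrite zpow1|right; rewrite zpowN zpow1 invgK].
- rewrite big_cons actM ev tb' /twisted addr0 !actM -!(actM a (zpow x _) (zpow x _)) -!zpowD.
  by congr (a _ (a _ (a (zpow x _) _))); ring.
- by right.
Qed.

Lemma pingpong w : (forall t, t \in w -> letter t) -> sorted (fun s t => s * t != 1)%g w ->
  (0 < size w < n)%N -> (\prod_(t <- w) t)%g <> 1%g.
Proof.
move=> lw sw /andP[w0 wn] w1; have [N [v [b [r [Nw Vv ev rw H]]]]] := pingpong_inv lw sw wn.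
(* A nonzero exponent on the right puts [z] in [W N], a contradiction. The exponent could vanish
   only if no twisted letter occurs, but then [r] is nonzero, the word being nonempty and
   reduced. *)
have : a (zpow x E) (a (zpow x (- E)) z) = a (zpow x (E + (n%:Z * b + r))) v.
  by rewrite zpowD actM -ev w1 act1.
rewrite -actM -zpowD subrr act1 => ze; apply: (@Wz N); rewrite ze; apply: VW => //.
  exact: leq_trans Nw (ltnW wn).
case: w w0 H {lw sw w1 ev Nw} wn rw => //= s w _ H wn rw; rewrite /E addrA -mulrDr.
have [bb|bb] := eqVneq ((size gs).+1%:Z + b) 0; last exact: mulDn_neq0 (leq_ltn_trans rw wn) bb.
rewrite bb mulr0 add0r; apply/eqP => r0.
case: H => [[d _ []]|[_ bP _]]; [by rewrite r0 mul0r|lia].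
Qed.

End PingPong.

(** * Small elements *)

Lemma seq_small (R : realType) (T : eqType) (s : seq T) (P : T -> R -> Prop) :
  (forall t, t \in s -> exists2 d : R, 0 < d & forall e, e <= d -> P t e) ->
  exists2 d : R, 0 < d & forall t, t \in s -> P t d.
Proof.
move=> H; suff [d d0 dP] : exists2 d : R, 0 < d & forall e, e <= d -> forall t, t \in s -> P t e.
  by exists d => //; exact: dP.
elim: s H => [|t s IH] H; first by exists 1.
have [|d d0 dP] := IH; first by move=> u us; apply: H; rewrite inE us orbT.
have [d' d'0 d'P] := H t (mem_head _ _).
exists (Num.min d d'); first by rewrite lt_min d0.
move=> e; rewrite le_min => /andP[ed ed'] u; rewrite inE => /orP[/eqP ->|].
  exact: d'P.
exact: dP.
Qed.

Lemma seq_large (T : eqType) (s : seq T) (P : T -> nat -> Prop) :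
  (forall t, t \in s -> exists n, forall m, (n <= m)%N -> P t m) ->
  exists n, forall m, (n <= m)%N -> forall t, t \in s -> P t m.
Proof.
elim: s => [|t s IH] H; first by exists 0%N.
have [|n nP] := IH; first by move=> u us; apply: H; rewrite inE us orbT.
have [n' n'P] := H t (mem_head _ _).
exists (maxn n n') => m; rewrite geq_max => /andP[nm n'm] u; rewrite inE => /orP[/eqP ->|].
  exact: n'P.
exact: nP.
Qed.

Lemma avoid_seq (R : realType) (s : seq R) (p q : R) : p < q -> exists2 z, p < z < q & z \notin s.
Proof.
move=> pq; have [d [d0 _ dP]] := lower_bound [seq x - p | x <- s].
pose w := Num.min d (q - p) / 2; have w0 : 0 < w by rewrite divr_gt0// lt_min d0 subr_gt0.
have [wd wq] : w < d /\ w < q - p.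
  have : Num.min d (q - p) <= Num.min d (q - p) by [].
  by rewrite {2}/Order.min le_min => /andP[]; rewrite /w in w0 *; split; lra.
exists (p + w); first by apply/andP; split; lra.
apply/negP => zs; have := dP _ (map_f (fun x => x - p) zs).
by rewrite addrAC subrr add0r => /(_ w0); rewrite leNgt wd.
Qed.

Lemma closest_below (R : realType) (s : seq R) (v : R) : (exists2 x, x \in s & x < v) ->
  exists p, [/\ p \in s, p < v & forall x, x \in s -> x < v -> x <= p].
Proof.
move=> [x0]; elim: s x0 => // y s IH x0; rewrite inE => x0s x0v.
have [[x xs xv]|C] := pselect (exists2 x, x \in s & x < v).
  have [p [ps pv pP]] := IH x xs xv.
  have [yv|vy] := ltP y v; last first.
    exists p; split=> // [|z]; first by rewrite inE ps orbT.
    by rewrite inE => /orP[/eqP ->|/pP//]; rewrite ltNge vy.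
  exists (Num.max y p); split; first by rewrite inE; case: leP => _; rewrite ?eqxx ?ps ?orbT.
    by rewrite gt_max yv.
  by move=> z; rewrite inE le_max => /orP[/eqP ->|/pP H /H ->]; rewrite ?lexx ?orbT.
exists x0; split=> // z; rewrite inE => /orP[/eqP ->|zs]; last by move=> zv; case: C; exists z.
by case/orP: x0s => [/eqP ->//|x0s]; case: C; exists x0.
Qed.

Lemma closest_above (R : realType) (s : seq R) (v : R) : (exists2 x, x \in s & v < x) ->
  exists p, [/\ p \in s, v < p & forall x, x \in s -> v < x -> p <= x].
Proof.
move=> [x xs vx]; have [|p [/mapP[q qs ->] pv pP]] := @closest_below R (map -%R s) (- v).
  by exists (- x); [exact: map_f|rewrite ltrN2].
exists q; split=> // [|y ys vy]; first by rewrite -ltrN2.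
by rewrite -lerN2; apply: pP; [exact: map_f|rewrite ltrN2].
Qed.

(** * Local transitivity and general position *)

Section Dynamics.
Variables (R : realType) (G : groupType) (a : itv_action R G).
Implicit Types (g h A f : G) (x y p q e : R).

Definition near_id e g := forall x, 0 < x < 1 -> `|a g x - x| < e.

Lemma near_idV e g : near_id e g -> near_id e g^-1%g.
Proof. by move=> H x x01; have := H (a g^-1%g x); rewrite act_itv actVK distrC; exact. Qed.

Lemma near_idM e e' g h : near_id e g -> near_id e' h -> near_id (e + e') (g * h)%g.
Proof.
move=> Hg Hh x x01; rewrite actM; apply: le_lt_trans (ler_distD (a h x) _ _) _.
by apply: ltrD; [apply: Hg; rewrite act_itv|exact: Hh].
Qed.

Lemma near_id_le e e' g : e <= e' -> near_id e g -> near_id e' g.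
Proof. by move=> ee H x /H/lt_le_trans; exact. Qed.

Lemma near_id1 e : 0 < e -> near_id e 1%g.
Proof. by move=> e0 x _; rewrite act1 subrr normr0. Qed.

Lemma robust_lt h p q : 0 < p < 1 -> 0 < q < 1 -> a h p < q ->
  exists2 e, 0 < e & forall e', e' <= e -> forall g, near_id e' g -> a h (a g p) < a g q.
Proof.
move=> p01 q01 hpq; pose r := (a h p + q) / 2; have hr : a h p < r by rewrite /r; lra.
have rq : r < q by rewrite /r; lra.
exists (Num.min (a h^-1%g r - p) (q - r)); first by rewrite lt_min !subr_gt0 lt_actV hr.
move=> e'; rewrite le_min => /andP[e1 e2] g gn.
have := gn _ p01; have := gn _ q01; rewrite !ltr_norml => /andP[q1 q2] /andP[p1 p2].
apply: (@lt_trans _ _ r); last by lra.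
by rewrite -lt_actV; lra.
Qed.

Lemma robust_neq h p q : 0 < p < 1 -> 0 < q < 1 -> a h p <> q ->
  exists2 e, 0 < e & forall e', e' <= e -> forall g, near_id e' g -> a h (a g p) <> a g q.
Proof.
move=> p01 q01; case: (ltgtP (a h p) q) => // hpq _.
  have [e e0 eP] := robust_lt p01 q01 hpq; exists e => // e' e'e g gn E.
  by have := eP _ e'e _ gn; rewrite E ltxx.
have hqp : a h^-1%g q < p by rewrite actV_lt.
have [e e0 eP] := robust_lt q01 p01 hqp; exists e => // e' e'e g gn E.
by have := eP _ e'e _ gn; rewrite actV_lt E ltxx.
Qed.

(* Induction on the number k of levels of height e / 3 below A y. *)
Lemma act_unif_cont A e : 0 < e ->
  exists2 d, 0 < d & forall x y, 0 < x < 1 -> 0 < y < 1 -> `|x - y| < d -> `|a A x - a A y| < e.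
Proof.
move=> e0; pose e2 := e / 3; have e20 : 0 < e2 by rewrite /e2; lra.
suff H k : exists2 d, 0 < d &
    forall x y, 0 <= x <= y -> y - x < d -> a A y <= k%:R * e2 -> a A y - a A x <= 2 * e2.
  have [d d0 dP] := H (Num.bound e2^-1).
  have k1 : 1 <= (Num.bound e2^-1)%:R * e2.
    have i0 : 0 <= e2^-1 by rewrite invr_ge0 ltW.
    by have := archi_boundP i0; rewrite -div1r ltr_pdivrMr// => /ltW.
  exists d => // x y x01 y01.
  wlog xy : x y x01 y01 / x <= y => [W|].
    case/orP: (le_total x y) => [|yx xd]; first exact: W.
    by rewrite distrC; apply: W => //; rewrite distrC.
  have xy' : a A x <= a A y by rewrite act_le.
  rewrite ler0_norm ?subr_le0// ler0_norm ?subr_le0// !opprB => yxd.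
  apply: (@le_lt_trans _ _ (2 * e2)); last by rewrite /e2; lra.
  case/andP: x01 => x0 _; case/andP: y01 => _ y1; apply: dP => //; first by rewrite ltW.
  by apply: le_trans k1; apply/ltW; rewrite act_lt1.
elim: k => [|k [d d0 IH]].
  exists 1 => // x y /andP[x0 _] _; rewrite mul0r => y0.
  have : 0 <= a A x by rewrite -(act_0 a A) act_le.
  by lra.
exists (Num.min d (a A^-1%g (k%:R * e2) - a A^-1%g ((k%:R - 1) * e2))).
  by rewrite lt_min d0 subr_gt0 act_lt ltr_pM2r//; lra.
move=> x y xy; rewrite lt_min => /andP[yd yd'] yk.
have [|yk'] := leP (a A y) (k%:R * e2); first exact: IH.
have xk : a A^-1%g ((k%:R - 1) * e2) < x by move: yk'; rewrite -actV_lt; lra.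
by move: xk; rewrite actV_lt; rewrite -natr1 in yk; lra.
Qed.

Hypothesis ltr : forall p, 0 < p < 1 -> forall e, 0 < e -> exists2 g, near_id e g & a g p <> p.

(** It suffices to displace [p], by less than its distance to the other points of [s]. *)
Lemma orbit_infinite p e (s : seq R) : 0 < p < 1 -> 0 < e -> exists2 g, near_id e g & a g p \notin s.
Proof.
move=> p01 e0; have [d [d0 _ dP]] := lower_bound [seq `|x - p| | x <- s].
have [|g gn gp] := ltr p01 (_ : 0 < Num.min d e); first by rewrite lt_min d0.
exists g; first by apply: near_id_le gn; rewrite ge_min lexx orbT.
apply/negP => /(map_f (fun x => `|x - p|))/dP; rewrite normr_gt0 subr_eq0 => /(_ (introN eqP gp)).
have := gn p p01; rewrite lt_min ltNge => /andP[/negP h _]; exact: h.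
Qed.

Lemma fix_finite g : g <> 1%g -> exists s : seq R, forall x, (x \in s) = (0 < x < 1) && (a g x == x).
Proof.
move=> /(act_fin a)[s sP]; exists [seq x <- s | (0 < x < 1) && (a g x == x)] => x.
rewrite mem_filter; apply/andP/idP => [[]//|xx]; split=> //.
by case/andP: xx => x01 /eqP gx; exact: sP.
Qed.

Hypothesis chains : forall k, exists2 m, pos a m & dominated_by (pos a) k m.

Lemma alternating_fix k (l : seq G) : 1%g \in l ->
  exists A b u v, alternating a A l k.+1 b u v.
Proof.
move=> l1; have [m Pm mk] := chains k.
have [f Pf] := dominates_top (j := 0) Pm I mk; rewrite addn0 => fk.
by have [A [b [u [v [_ alt]]]]] := alternating_ex Pf fk l1; exists A, b, u, v.
Qed.

Lemma no_fix_right g p : (forall x, 0 < x < 1 -> a g x <> x) -> 0 < p < 1 -> p < a g p ->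
  forall x, 0 < x < 1 -> x < a g x.
Proof.
move=> H p01 gp x x01; apply: (@sign_const _ _ a g (Num.min p x) (Num.max p x) p) => //.
- move=> y /andP[]; rewrite ge_min le_max => y1 y2; apply: H; apply/andP; split.
    by case/orP: y1 => ?; lra.
  by case/orP: y2 => ?; lra.
- by rewrite ge_min le_max lexx.
- by rewrite ge_min le_max lexx !orbT.
Qed.

(* If g commuted with all small elements, the latter would have no fixed point; but the commutator
   of a small element with an element of alternating sign is small and has one. *)
Lemma small_centralizer g d : 0 < d -> (forall h, near_id d h -> (g * h = h * g)%g) -> g = 1%g.
Proof.
move=> d0 gC; apply: contrapT => g1; have [s sP] := act_fin a g1.
(* Small elements would carry a fixed point of [g] to infinitely many others. *)
have gfree p : 0 < p < 1 -> a g p <> p.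
  move=> p01 gp; have [h hd /negP] := orbit_infinite s p01 d0; apply; apply: sP.
    by rewrite act_itv.
  by rewrite -actM gC// actM gp.
have hfree h p : near_id d h -> h <> 1%g -> 0 < p < 1 -> a h p <> p.
  move=> hd /(act_fin a)[s' s'P] p01 hp; apply: (gfree p p01).
  apply: (@finite_orbit_fix _ _ a g p s') => n; apply: s'P; first by rewrite act_itv.
  suff e : (h * g ^+ n = g ^+ n * h)%g by rewrite -actM e actM hp.
  elim: n => [|n IH]; first by rewrite expg0 mulg1 mul1g.
  by rewrite expgS mulgA -gC// -!mulgA IH.
have [A [b [u [v alt]]]] := alternating_fix 3 (mem_head 1%g [::]).
have H i : (i < 4)%N -> [/\ 0 < u i, u i <= v i, v i < 1, ((i.+1 < 4)%N -> v i < u i.+1) &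
    forall x, u i <= x <= v i -> moves a A (odd i (+) b) x].
  move=> i4; have [u0 v1 uv vu mv] := alt i i4; split=> //.
  by have := uv _ (mem_head _ _); rewrite act1.
(* Three consecutive intervals moved right, left, right are wanted; they may start at index 1,
   whence four intervals. On the left of the fixed points [p1] and [p2] found between them, [A]
   moves points right and left respectively. *)
have [i [i2 ib]] : exists i, (i < 2)%N /\ odd i (+) b = true by exists (~~ b); case: (b).
have i4 : (i.+2 < 4)%N := i2.
have [u0 uv0 v0 vu0 mv0] := H i (ltnW (ltnW i4)).
have [u1 uv1 v1 vu1 mv1] := H i.+1 (ltnW i4).
have [u2 uv2 v2 vu2 mv2] := H i.+2 i4.
have {}vu0 := vu0 (ltnW i4); have {}vu1 := vu1 i4.
have A0 : v i < a A (v i) by have := mv0 (v i); rewrite uv0 lexx ib => /(_ isT).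
have A1 : a A (u i.+1) < u i.+1 by have := mv1 (u i.+1); rewrite uv1 lexx addNb ib => /(_ isT).
have A1' : a A (v i.+1) < v i.+1 by have := mv1 (v i.+1); rewrite uv1 lexx addNb ib => /(_ isT).
have A2 : u i.+2 < a A (u i.+2) by have := mv2 (u i.+2); rewrite uv2 lexx /= negbK ib => /(_ isT).
have [p1 [/andP[vp1 p1u] Ap1 p1P]] := first_fix vu0 A0 A1.
have [p2 [/andP[vp2 p2u] Ap2 p2P]] := first_fixV vu1 A1' A2.
have p12 : p1 < p2 by lra.
have p101 : 0 < p1 < 1 by apply/andP; split; lra.
have p201 : 0 < p2 < 1 by apply/andP; split; lra.
have d2 : 0 < d / 2 by lra.
have [r r0 rP] := act_unif_cont A d2.
(* The first two terms keep the commutator within [d] of the identity; the last two keep the images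
   of [p1] and [p2] under [n^-1] where the direction of [A] is known. *)
pose r' := Num.min (Num.min r (d / 2)) (Num.min (p1 - v i) (p2 - v i.+1)).
have r'0 : 0 < r' by rewrite !lt_min r0 d2 !subr_gt0 vp1.
have [n nr np] : exists2 n, near_id r' n & forall x, 0 < x < 1 -> x < a n x.
  have [n nr np] := ltr p101 r'0.
  have n1 : n <> 1%g by move=> e; apply: np; rewrite e act1.
  have nd : near_id d n by apply: near_id_le nr; rewrite !ge_min; apply/orP; left; apply/orP; right; lra.
  case: (ltgtP p1 (a n p1)) => [pn|np'|/esym//].
    by exists n => //; apply: no_fix_right pn => // x; exact: hfree.
  exists n^-1%g; first exact: near_idV.
  apply: (@no_fix_right _ p1); rewrite ?lt_actV// => x x01; apply: hfree => //.
    exact: near_idV.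
  by move=> e; apply: n1; rewrite -[n]invgK e invg1.
move: (nr); rewrite /r' => nr'.
have nV := near_idV nr'.
pose c := (n * A * n^-1 * A^-1)%g.
have cd : near_id d c.
  move=> x x01; have [y y01 ->] : exists2 y, 0 < y < 1 & x = a A y.
    by exists (a A^-1%g x); rewrite ?act_itv ?actVK.
  rewrite /c !actM actK.
  have n01 : 0 < a n^-1%g y < 1 by rewrite act_itv.
  have := nV y y01; rewrite !lt_min => /andP[/andP[/(rP _ _ n01 y01) h1 _] _].
  have An01 : 0 < a A (a n^-1%g y) < 1 by rewrite act_itv.
  have := nr' _ An01; rewrite !lt_min => /andP[/andP[_ h2] _].
  apply: le_lt_trans (ler_distD (a A (a n^-1%g y)) _ _) _.
  by apply: lt_le_trans (ltrD h2 h1) _; lra.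
have np1 : a n^-1%g p1 < p1 by rewrite actV_lt np.
have np2 : a n^-1%g p2 < p2 by rewrite actV_lt np.
have c1 : p1 < a c p1.
  rewrite /c !actM (actV_fix Ap1) -actV_lt; apply: p1P; rewrite np1 andbT.
  by have := nV _ p101; rewrite !lt_min ltr_norml => /andP[_ /andP[]]; rewrite ltr_norml; lra.
have c2 : a c p2 < p2.
  rewrite /c !actM (actV_fix Ap2) -lt_actV; apply: p2P; rewrite np2 andbT.
  by have := nV _ p201; rewrite !lt_min => /andP[_ /andP[_]]; rewrite ltr_norml; lra.
have [p [/andP[pp1 pp2] cp _]] := first_fix p12 c1 c2.
apply: (hfree c p) => //; last by apply/andP; split; lra.
by move=> e; move: c1; rewrite e act1 ltxx.
Qed.

(** If [g (h p) = h (g p)] for all small [h], then using this for [h'] and for [h * h'] shows that a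
    commutator of [g] and [h] fixes every [h' p]. These points are infinitely many, so [g] commutes
    with all small elements. *)
Lemma avoid1 g p q e : g <> 1%g -> 0 < p < 1 -> 0 < e ->
  exists2 h, near_id e h & a g (a h p) <> a h q.
Proof.
move=> g1 p01 e0; have [eq|] := pselect (a g p = q); last first.
  by exists 1%g; [exact: near_id1|rewrite !act1].
apply: contrapT => C; apply: g1; have e2 : 0 < e / 2 by lra.
have H h : near_id e h -> a g (a h p) = a h (a g p).
  by move=> hn; apply: contrapT; rewrite eq => ne; apply: C; exists h.
apply: (small_centralizer e2) => h hn; apply: contrapT => ne.
have k1 : (h^-1 * g^-1 * h * g)%g <> 1%g.
  by move=> k1; apply: ne; apply: (mulgI (g^-1)%g); apply: (mulgI (h^-1)%g); rewrite mulKg mulVg !mulgA.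
have [s sP] := act_fin a k1; have [h' hn' /negP] := orbit_infinite s p01 e2; apply.
apply: sP; first by rewrite act_itv.
have hh : near_id e (h * h')%g.
  by apply: near_id_le (near_idM hn hn'); lra.
have h'e : near_id e h' by apply: near_id_le hn'; lra.
by rewrite !actM H// -[a h (a h' _)]actM -H// !actM !actK.
Qed.

(** Each condition is open, so the correction made for a new triple can be small enough to preserve
    the earlier ones. *)
Lemma avoid (L : seq (G * R * R)) e : 0 < e ->
  (forall t, t \in L -> [/\ t.1.1 <> 1%g, 0 < t.1.2 < 1 & 0 < t.2 < 1]) ->
  exists2 g, near_id e g & forall t, t \in L -> a t.1.1 (a g t.1.2) <> a g t.2.
Proof.
elim: L e => [|t L IH] e e0 H; first by exists 1%g => //; exact: near_id1.
have [||g gn gP] := IH (e / 2); [by lra| |].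
  by move=> u uL; apply: H; rewrite inE uL orbT.
have [g1 p01 q01] := H t (mem_head _ _).
have [|d d0 dP] := @seq_small R _ L (fun t e => forall h, near_id e h ->
  a t.1.1 (a h (a g t.1.2)) <> a h (a g t.2)).
  move=> u uL; have [_ u1 u2] : [/\ u.1.1 <> 1%g, 0 < u.1.2 < 1 & 0 < u.2 < 1].
    by apply: H; rewrite inE uL orbT.
  by apply: robust_neq; rewrite ?act_itv//; exact: gP.
have gp : 0 < a g t.1.2 < 1 by rewrite act_itv.
have [|h hn hP] := @avoid1 _ _ (a g t.2) (Num.min d (e / 2)) g1 gp; first by rewrite lt_min d0; lra.
exists (h * g)%g.
  have hn' : near_id (e / 2) h by apply: near_id_le hn; rewrite ge_min lexx orbT.
  by apply: near_id_le (near_idM hn' gn); lra.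
move=> u; rewrite inE !actM => /orP[/eqP ->//|uL]; apply: dP => //.
by apply: near_id_le hn; rewrite ge_min lexx.
Qed.

(** [A] reverses direction across each gap between long intervals, whence a fixed point there; the
    next long interval stops [L] from carrying it to the next fixed point. A small conjugation keeps
    these strict inequalities and brings the finite fixed point set into general position. *)
Lemma good_element (L : seq G) k : 1%g \notin L ->
  exists (y : G) (q : nat -> R), [/\ y <> 1%g,
    forall i, (i <= k)%N -> 0 < q i < 1 /\ a y (q i) = q i,
    forall i, (i < k)%N -> q i < q i.+1,
    forall i g, (i < k)%N -> g \in L -> a g (q i) < q i.+1 &
    forall p p' g, 0 < p < 1 -> 0 < p' < 1 -> a y p = p -> a y p' = p' -> g \in L -> a g p <> p'].
Proof.
move=> L1; have [A [b [u [v alt]]]] := alternating_fix k.+1 (mem_head 1%g L).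
have A1 : A <> 1%g.
  move=> e; have [_ _ /(_ _ (mem_head _ _)) + _ /(_ (u 0%N))] := alt 0%N isT.
  by rewrite act1 => uv; rewrite e /moves act1 lexx uv; case: ifP => _; rewrite ltxx => /(_ isT).
have qex i : exists q, (i <= k)%N -> v i < q < u i.+1 /\ a A q = q.
  have [ik|] := leqP i k; last by exists 0.
  have [u0 _ /(_ _ (mem_head _ _)) uv vu mv] := alt i (leqW ik).
  have [_ v1 /(_ _ (mem_head _ _)) uv' _ mv'] := alt i.+1 ik.
  rewrite !act1 in uv uv'; have {}vu := vu ik.
  have := mv (v i); rewrite lexx uv => /(_ isT).
  have := mv' (u i.+1); rewrite lexx uv' => /(_ isT).
  rewrite /= addNb; case: (odd i (+) b) => /= m1 m2.
    by have [q [vq Aq _]] := first_fix vu m2 m1; exists q.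
  by have [q [vq Aq _]] := first_fixV vu m2 m1; exists q.
have [q qP] := choice qex.
have q01 i : (i <= k)%N -> 0 < q i < 1.
  move=> ik; have [/andP[q1 q2] _] := qP i ik.
  have [u0 _ /(_ _ (mem_head _ _)) uv vu mv] := alt i (leqW ik).
  have [_ v1 /(_ _ (mem_head _ _)) uv' _ mv'] := alt i.+1 ik.
  by rewrite !act1 in uv uv'; apply/andP; split; lra.
have qlt i g : (i < k)%N -> g \in 1%g :: L -> a g (q i) < q i.+1.
  move=> ik gL; have [/andP[_ q2] _] := qP i (ltnW ik); have [/andP[q1 _] _] := qP i.+1 ik.
  have [_ _ /(_ _ gL) uv' _ _] := alt i.+1 (leqW ik).
  by apply: lt_trans q1; apply: lt_le_trans uv'; rewrite act_lt.
have [F FP] := fix_finite A1.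
have [|d d0 dP] := @seq_small R _ [seq (i, g) | i <- iota 0 k, g <- 1%g :: L]
  (fun t e => forall h, near_id e h -> a t.2 (a h (q t.1)) < a h (q t.1.+1)).
  move=> _ /allpairsP[[i g] [/= + gL ->]]; rewrite mem_iota add0n => ik /=.
  by apply: robust_lt; [exact/q01/ltnW|exact: q01|exact: qlt].
have [|h hn hP] := @avoid [seq (gp, p') | gp <- [seq (g, p) | g <- L, p <- F], p' <- F] _ d0.
  move=> _ /allpairsP[[gp p'] [/= /allpairsP[[g p] [/= gL pF ->]] p'F ->]] /=.
  move: pF p'F; rewrite !FP => /andP[-> _] /andP[-> _]; split=> // g1; move: L1.
  by rewrite -g1 gL.
have fixJ x : a (h * A * h^-1)%g x = x -> a A (a h^-1%g x) = a h^-1%g x.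
  by rewrite !actM => {2}<-; rewrite actK.
exists (h * A * h^-1)%g, (fun i => a h (q i)); split.
- move=> e; apply: A1; have := congr1 (fun w => h^-1 * w * h)%g e.
  by rewrite !mulgA mulVg mul1g mulgVK mulg1 mulVg.
- by move=> i ik; rewrite act_itv !actM actK; split; [exact: q01|have [_ ->] := qP i ik].
- by move=> i ik; rewrite act_lt; have := qlt i _ ik (mem_head _ _); rewrite act1.
- move=> i g ik gL; apply: (dP (i, g)) hn; apply/allpairsP; exists (i, g); split=> //.
    by rewrite mem_iota.
  by rewrite inE gL orbT.
- move=> p p' g p01 p'01 /fixJ yp /fixJ yp' gL.
  have := hP ((g, a h^-1%g p), a h^-1%g p'); rewrite /= !actVK; apply.
  by apply: allpairs_f; [apply: allpairs_f => //|]; rewrite FP act_itv ?p01 ?p'01 ?yp ?yp' eqxx.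
Qed.

End Dynamics.

(** * Ping-pong around the fixed points of one element *)

Section ShortWords.
Variables (R : realType) (G : groupType) (a : itv_action R G).

Definition near_seq (F : seq R) (e x : R) := exists2 p, p \in F & `|x - p| < e.

Lemma gap_escape y (F : seq R) e p p' : 0 < e -> (forall x, (x \in F) = (0 < x < 1) && (a y x == x)) ->
  p \in F -> p' \in F -> (forall x, x \in F -> ~ p < x < p') ->
  exists n, forall m, (n <= m)%N -> forall x, p < x < p' -> ~ near_seq F e x ->
    near_seq F e (a (y ^+ m)%g x) /\ near_seq F e (a (y ^- m)%g x).
Proof.
(* Up to exchanging [y] and its inverse, [y] moves points of the gap to the right, unless the gap is
   too short to contain a point far from [F]. *)
move=> e0 FP; wlog : y FP / p' - e < p + e \/ p + e < a y (p + e) => [W pF p'F gap|].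
  have [pe|pe] := ltP (p' - e) (p + e); first by apply: (W y) => //; left.
  have [ype|] := ltP (p + e) (a y (p + e)); first by apply: (W y) => //; right.
  rewrite le_eqVlt => /orP[/eqP ye|ye].
    have pp' : p < p + e < p' by apply/andP; split; lra.
    move: pF p'F; rewrite !FP => /andP[/andP[p0 p1] _] /andP[/andP[p'0 p'1] _].
    case: (gap (p + e)) => //; rewrite FP ye eqxx andbT; apply/andP; split; lra.
  have [|||||n nP] := W y^-1%g => //.
  - move=> x; rewrite FP; congr (_ && _); apply/eqP/eqP => [|h]; first exact: actV_fix.
    by rewrite -[in LHS]h actVK.
  - by right; rewrite lt_actV.
  by exists n => m /nP H x px /(H x px) []; rewrite -!expVgn invgK.
move=> H pF p'F gap; move: (pF) (p'F); rewrite !FP => /andP[/andP[p0 p1] /eqP yp] /andP[/andP[p'0 p'1] /eqP yp'].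
have far x : p < x < p' -> ~ near_seq F e x -> p + e <= x <= p' - e.
  move=> /andP[px xp'] xF; apply/andP; split; rewrite leNgt; apply/negP => C; apply: xF.
    by exists p => //; rewrite ltr_norml; apply/andP; split; lra.
  by exists p' => //; rewrite ltr_norml; apply/andP; split; lra.
have [pe|pe] := ltP (p' - e) (p + e).
  by exists 0%N => m _ x px /(far x px); lra.
case: H => [|ype]; first by rewrite ltNge pe.
have [n nP] : exists n, forall m, (n <= m)%N -> p' - e < a (y ^+ m)%g (p + e).
  apply: iter_escape => // x xp; apply: (@sign_const _ _ a y (p + e) (p' - e) (p + e)) => //; last by rewrite lexx.
  move=> t tp yt; apply: (gap t); last by lra.
  by rewrite FP yt eqxx andbT; apply/andP; split; lra.
exists n => m nm x px /(far x px) /andP[x1 x2]; have := nP m nm.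
have yx z : a (y ^+ m)%g z = z -> a (y ^- m)%g z = z by exact: actV_fix.
have ymp := actX_fix m yp; have ymp' := actX_fix m yp'.
case/andP: px => px xp' ym; split.
  exists p' => //; have : a (y ^+ m)%g (p + e) <= a (y ^+ m)%g x by rewrite act_le.
  have : a (y ^+ m)%g x < a (y ^+ m)%g p' by rewrite act_lt.
  by rewrite ymp' ltr_norml => *; apply/andP; split; lra.
exists p => //; have : a (y ^- m)%g p < a (y ^- m)%g x by rewrite act_lt.
have : a (y ^- m)%g x < p + e by rewrite actV_lt; lra.
by rewrite (yx p)// ltr_norml => *; apply/andP; split; lra.
Qed.

Hypothesis ltr : forall p, 0 < p < 1 -> forall e, 0 < e -> exists2 g, near_id a e g & a g p <> p.
Hypothesis chains : forall k, exists2 m, pos a m & dominated_by (pos a) k m.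

Lemma short_words (gs : seq G) n : 1%g \notin gs -> exists x, forall w,
  (forall t, t \in w -> letter x gs n t) -> sorted (fun s t => s * t != 1)%g w ->
  (0 < size w < n)%N -> (\prod_(t <- w) t)%g <> 1%g.
Proof.
move=> gs1; pose L := gs ++ [seq g^-1%g | g <- gs].
have L1 : 1%g \notin L.
  rewrite mem_cat negb_or gs1; apply/mapP => -[g ggs /(congr1 (fun u => u^-1%g))].
  by rewrite invg1 invgK => g1; rewrite g1 ggs in gs1.
have LP g : g \in gs \/ g^-1%g \in gs -> g \in L /\ g^-1%g \in L.
  rewrite /L !mem_cat => -[gg|gg]; split; rewrite ?gg//.
    by rewrite map_f ?orbT.
  by apply/orP; right; rewrite -[g in g \in _]invgK map_f.
(* The 2n + 2 points [q] leave room for n steps on either side of the middle gap, where [z] is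
   taken. *)
have [y [q [y1 qfix qlt qL yL]]] := good_element ltr chains (n + n).+1 L1.
have [F FP] := fix_finite a y1.
have [z /andP[nz zn] zF] := avoid_seq F (qlt n (leq_addr _ _)).
have [|e1 e10 e1P] := @seq_small R _ F (fun p e => e <= `|z - p|).
  move=> p pF; exists `|z - p| => //; rewrite normr_gt0 subr_eq0.
  by apply: contraNneq zF => ->.
(* Since [g p] differs from [p'], a neighbourhood of [p] is kept away from [p']; the midpoint of
   [g p] and [p'] gives its size. *)
have [|e2 e20 e2P] := @seq_small R _ [seq (gp, p') | gp <- [seq (g, p) | g <- L, p <- F], p' <- F]
    (fun t e => forall x, `|x - t.1.2| < e -> e <= `|a t.1.1 x - t.2|).
  move=> _ /allpairsP[[gp p'] [/= /allpairsP[[g p] [/= gL pF ->]] p'F ->]] /=.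
  move: pF p'F; rewrite !FP => /andP[p01 /eqP yp] /andP[p'01 /eqP yp'].
  have := yL _ _ _ p01 p'01 yp yp' gL; case: (ltgtP (a g p) p') => // pp' _.
    pose r := (a g p + p') / 2; have gr : a g p < r by rewrite /r; lra.
    exists (Num.min (a g^-1%g r - p) (p' - r)).
      by rewrite lt_min !subr_gt0 lt_actV gr /r; lra.
    move=> e; rewrite le_min => /andP[er1 er2] x; rewrite ltr_norml => /andP[_ xp].
    have xr : x < a g^-1%g r by lra.
    by rewrite lt_actV in xr; rewrite ler_normr; apply/orP; right; lra.
  pose r := (a g p + p') / 2; have gr : r < a g p by rewrite /r; lra.
  exists (Num.min (p - a g^-1%g r) (r - p')).
    by rewrite lt_min !subr_gt0 actV_lt gr /r; lra.
  move=> e; rewrite le_min => /andP[er1 er2] x; rewrite ltr_norml => /andP[xp _].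
  have xr : a g^-1%g r < x by lra.
  by rewrite actV_lt in xr; rewrite ler_normr; apply/orP; left; lra.
pose e := Num.min e1 e2; have e0 : 0 < e by rewrite lt_min e10.
have Uz : ~ near_seq F e z.
  by move=> [p /e1P zp]; rewrite ltNge ge_min zp.
have UL g x : g \in L -> near_seq F e x -> ~ near_seq F e (a g x).
  move=> gL [p pF xp] [p' p'F]; rewrite ltNge => /negP; apply; rewrite ge_min.
  apply/orP; right; apply: (e2P ((g, p), p')).
    by apply: allpairs_f => //; exact: allpairs_f.
  by apply: lt_le_trans xp _; rewrite ge_min lexx orbT.
have [|K KP] := @seq_large _ [seq (p, p') | p <- F, p' <- F] (fun t m =>
   (forall x, x \in F -> ~ t.1 < x < t.2) -> forall x, t.1 < x < t.2 -> ~ near_seq F e x ->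
     near_seq F e (a (y ^+ m)%g x) /\ near_seq F e (a (y ^- m)%g x)).
  move=> _ /allpairsP[[p p'] [/= pF p'F ->]] /=.
  have [gap|] := pselect (forall x, x \in F -> ~ p < x < p'); last by exists 0%N.
  by have [m mP] := gap_escape e0 FP pF p'F gap; exists m => m' /mP.
have qF i : (i <= (n + n).+1)%N -> q i \in F.
  by move=> /qfix[q01 /eqP yq]; rewrite FP q01.
pose x := (y ^+ K.+1)%g; exists x => w.
(* Powers of [x] fix the ends of this window, and an element of [L] moves them by less than one step
   of [q]. *)
pose inV N v := q (n - N)%N < v < q (n + N).+1.
apply: (@pingpong _ _ a x gs n (fun N v => inV N v /\ ~ near_seq F e v) (fun N v => inV N v /\ near_seq F e v) z).
- by rewrite /inV subn0 addn0 nz zn.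
- by move=> N [].
- move=> N v k Nn [/andP[v1 v2] vU] k0.
  have i1 : (n - N <= (n + n).+1)%N by exact: leq_trans (leq_subr _ _) (leqW (leq_addr _ _)).
  have i2 : ((n + N).+1 <= (n + n).+1)%N by rewrite ltnS leq_add2l.
  have [p [pF pv pP]] : exists p, [/\ p \in F, p < v & forall x, x \in F -> x < v -> x <= p].
    by apply: closest_below; exists (q (n - N)%N) => //; exact: qF.
  have [p' [p'F p'v p'P]] : exists p, [/\ p \in F, v < p & forall x, x \in F -> v < x -> p <= x].
    by apply: closest_above; exists (q (n + N).+1) => //; exact: qF.
  have gap t : t \in F -> ~ p < t < p'.
    move=> tF /andP[pt tp']; case: (ltgtP t v) => [/(pP _ tF)|/(p'P _ tF)|tv].
    - by rewrite leNgt pt.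
    - by rewrite leNgt tp'.
    - by apply: vU; exists t; rewrite // tv subrr normr0.
  have Kk : (K <= K.+1 * `|k|)%N by apply: leq_trans (leqnSn K) _; rewrite leq_pmulr// absz_gt0.
  have pvp' : p < v < p' by rewrite pv.
  have [U1 U2] := KP _ Kk (p, p') (allpairs_f _ pF p'F) gap v pvp' vU.
  have : a (zpow x k) v = a (y ^+ (K.+1 * `|k|))%g v \/ a (zpow x k) v = a (y ^- (K.+1 * `|k|))%g v.
    by rewrite expgnA; case: (k) => j; [left|right].
  have [_ yq1] := qfix _ i1; have [_ yq2] := qfix _ i2.
  case=> ->; split=> //; apply/andP; split.
  - by rewrite -(actX_fix (K.+1 * `|k|) yq1) act_lt.
  - by rewrite -(actX_fix (K.+1 * `|k|) yq2) act_lt.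
  - by rewrite -(actV_fix (actX_fix (K.+1 * `|k|) yq1)) act_lt.
  - by rewrite -(actV_fix (actX_fix (K.+1 * `|k|) yq2)) act_lt.
- move=> N v g Nn [/andP[v1 v2] vU] /LP[gL gL']; split; last exact: UL.
  apply/andP; split.
    apply: (@lt_trans _ _ (a g (q (n - N)%N))); last by rewrite act_lt.
    by rewrite -(subnSK Nn) -actV_lt; apply: qL => //; rewrite ltnS (leq_trans (leq_subr _ _)) ?leq_addr.
  apply: (@lt_trans _ _ (a g (q (n + N).+1))); first by rewrite act_lt.
  by rewrite addnS; apply: qL => //; rewrite ltnS ltn_add2l.
Qed.

End ShortWords.

(** * Cayley graphs *)

(** The quotients of consecutive vertices telescope to 1. Two adjacent ones cancel only if vertices
    two steps apart coincide; where the cycle closes, this is excluded by its having at least three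
    vertices. *)
Lemma cycle_word (G : groupType) (e : rel G) (P : G -> Prop) c :
  (forall g h, e g h -> P (g^-1 * h)%g) -> ucycle e c -> (3 <= size c)%N ->
  exists w, [/\ forall t, t \in w -> P t, sorted (fun s t => s * t != 1)%g w,
    size w = size c & (\prod_(t <- w) t)%g = 1%g].
Proof.
case: c => // g p eP /andP[ep up] sp; set s := rcons p g.
have ss : size s = (size p).+1 by rewrite size_rcons.
exists (pairmap (fun g h => g^-1 * h)%g g s); split.
- move: ep; rewrite [cycle _ _]/= -/s; elim: s (g) {ss} => //= h s IH k /andP[kh hs] t.
  by rewrite inE => /orP[/eqP ->|/(IH h hs)//]; exact: eP.
- apply/(sortedP 1%g) => i; rewrite size_pairmap ss ltnS => isp.
  rewrite !(nth_pairmap g) ?ss// ?(ltnW isp)//= ?leqW//.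
  rewrite mulgA mulgK; apply/eqP => /(congr1 (fun t => nth g (g :: s) i * t)%g).
  rewrite mulVKg mulg1 => /eqP.
  have ni j : (j <= size p)%N -> nth g (g :: s) j = nth g (g :: p) j.
    by case: j => //= j jp; rewrite nth_rcons jp.
  rewrite (ni i) ?(ltnW isp)//.
  move: isp; rewrite leq_eqVlt => /orP[/eqP isp|isp].
    rewrite nth_rcons -isp ltnn eqxx -[X in X == _]/(nth g (g :: p) 0) nth_uniq//=.
      by case: i isp {ni} => // -[] //; case: (p) sp => // ? [].
    by rewrite -isp.
  rewrite -[nth g s i.+1]/(nth g (g :: s) i.+2) ni// nth_uniq//=.
    by rewrite gtn_eqF// ltnS leqnSn.
  by rewrite ltnW// ltnW.
- by rewrite size_pairmap.
- suff H t : (\prod_(t <- pairmap (fun g h => g^-1 * h) t s) t = t^-1 * last t s)%g.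
    by rewrite H last_rcons mulVg.
  elim: s t {ss} => [|h s IH] t; first by rewrite big_nil mulVg.
  by rewrite big_cons IH mulgA mulgK.
Qed.

Lemma generated_subgroup (G : groupType) (S : set G) : subgroup (generated S).
Proof.
split; first by rewrite inE => K [[K1 _] _]; move: K1; rewrite inE.
move=> g h; rewrite !inE => gS hS K KP; have [[_ KM] _] := KP.
have := KM g h; rewrite !inE; apply; [exact: gS|exact: hS].
Qed.

(** * Subgroups as groups in their own right *)

Section Subgroup.
Variables (G : groupType) (H : set G) (h : subgroup H).

Lemma subgroup1 : H 1%g. Proof. by have [] := h; rewrite inE. Qed.

Lemma subgroupV x : H x -> H x^-1%g.
Proof.
have [h1 hM] := h; move=> Hx; have := hM 1%g x h1; rewrite !inE mul1g; exact.
Qed.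

Lemma subgroupM x y : H x -> H y -> H (x * y)%g.
Proof.
move=> Hx /subgroupV Hy; have [_ hM] := h; have := hM x y^-1%g.
by rewrite !inE invgK; exact.
Qed.

Lemma subgroup_zpow x k : H x -> H (zpow x k).
Proof.
move=> Hx; have HX n : H (x ^+ n)%g.
  by elim: n => [|n IH]; [exact: subgroup1|rewrite expgS; exact: subgroupM].
by case: k => n; [exact: HX|apply: subgroupV; exact: HX].
Qed.

(* The phantom proof argument lets the group instance below be inferred. *)
Definition subgroup_type of subgroup H := {g : G | g \in H}.
End Subgroup.

HB.instance Definition _ (G : groupType) (H : set G) (h : subgroup H) :=
  Choice.copy (subgroup_type h) {g : G | g \in H}.

Section SubgroupType.
Variables (G : groupType) (H : set G) (h : subgroup H).
Let T := subgroup_type h.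

Definition sg_mk x (Hx : H x) : T := exist _ x (mem_set Hx).
Lemma sg_val (u : T) : H (sval u). Proof. exact/set_mem/(svalP u). Qed.
Definition sg_one : T := sg_mk (subgroup1 h).
Definition sg_inv (u : T) : T := sg_mk (subgroupV h (sg_val u)).
Definition sg_mul (u v : T) : T := sg_mk (subgroupM h (sg_val u) (sg_val v)).

Lemma sg_mulA : associative sg_mul.
Proof. by move=> u v w; apply: val_inj; exact: mulgA. Qed.
Lemma sg_mul1 : left_id sg_one sg_mul.
Proof. by move=> u; apply: val_inj; exact: mul1g. Qed.
Lemma sg_1mul : right_id sg_one sg_mul.
Proof. by move=> u; apply: val_inj; exact: mulg1. Qed.
Lemma sg_mulV : left_inverse sg_one sg_inv sg_mul.
Proof. by move=> u; apply: val_inj; exact: mulVg. Qed.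
Lemma sg_Vmul : right_inverse sg_one sg_inv sg_mul.
Proof. by move=> u; apply: val_inj; exact: mulgV. Qed.
End SubgroupType.

HB.instance Definition _ (G : groupType) (H : set G) (h : subgroup H) := isGroup.Build (subgroup_type h)
  (@sg_mulA _ _ h) (@sg_mul1 _ _ h) (@sg_1mul _ _ h) (@sg_mulV _ _ h) (@sg_Vmul _ _ h).

Section SubgroupTheory.
Variables (G : groupType) (H : set G) (h : subgroup H).
Let T := subgroup_type h.

Lemma sgM (u v : T) : sval (u * v)%g = (sval u * sval v)%g. Proof. by []. Qed.
Lemma sgV (u : T) : sval u^-1%g = (sval u)^-1%g. Proof. by []. Qed.
Lemma sg1 : sval (1%g : T) = 1%g. Proof. by []. Qed.
Lemma sg_inj : injective (@sval _ _ : T -> G). Proof. exact: val_inj. Qed.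

Lemma sgX (u : T) n : sval (u ^+ n)%g = (sval u ^+ n)%g.
Proof. by elim: n => [|n IH]; rewrite ?expg0 ?expgS ?sgM ?IH. Qed.

Lemma sg_zpow (u : T) k : sval (zpow u k) = zpow (sval u) k.
Proof. by case: k => n; rewrite /zpow ?sgV sgX. Qed.

End SubgroupTheory.

(** * Girth for twisted generating sets *)

Section Girth.
Variables (R : realType) (G : groupType) (H : set G) (h : subgroup H).
Let T := subgroup_type h.

Arguments twisted : simpl never.

Definition twisted_set (x : T) (gs : seq T) n : set G :=
  [set` sval x :: [seq sval (twisted x gs n i.+1%:Z) | i <- iota 0 (size gs)]].

Lemma zpow_in (K : set G) (x : T) k : subgroup K -> K (sval x) -> K (sval (zpow x k)).
Proof. by move=> Ks Kx; rewrite sg_zpow; exact: subgroup_zpow. Qed.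

Lemma generated_twisted (x : T) (gs : seq T) n (S : set G) : generated S = H ->
  (forall s, S s -> s <> 1%g -> exists2 g, g \in gs & sval g = s) ->
  generated (twisted_set x gs n) = H.
Proof.
move=> SH Sgs; rewrite eqEsubset; split.
  apply: smallest_sub => // t; rewrite /twisted_set /= inE => /orP[/eqP ->|/mapP[i _ ->]].
    exact: (sg_val x).
  exact: (sg_val (twisted x gs n i.+1%:Z)).
set K := generated _; have Ks : subgroup K by exact: generated_subgroup.
have KS t : twisted_set x gs n t -> K t by exact: sub_gen_smallest.
rewrite -SH; apply: smallest_sub => // s Ss; have [->|s1] := pselect (s = 1%g); first exact: subgroup1.
have [g ggs <-] := Sgs s Ss s1; pose i := index g gs.
have igs : (i < size gs)%N by rewrite index_mem.
have Kx : K (sval x) by apply: KS; exact: mem_head.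
have Kt : K (sval (twisted x gs n i.+1%:Z)).
  by apply: KS; rewrite /twisted_set /mkset in_cons; apply/orP; right; apply/mapP; exists i; rewrite ?mem_iota.
have -> : g = (zpow x (- (n%:Z * i.+1%:Z)) * twisted x gs n i.+1%:Z * zpow x (- (n%:Z * i.+1%:Z)))%g.
  rewrite /twisted zpowN !mulgA mulVg mul1g mulgK.
  by rewrite -[sgz _]/(1 : int) zpow1 -[`|_|%N.-1]/i nth_index.
rewrite !sgM; apply: (subgroupM Ks); last exact (zpow_in _ Ks Kx).
by apply: (subgroupM Ks) => //; exact (zpow_in _ Ks Kx).
Qed.

Lemma letterV (x : T) gs n t : letter x gs n t^-1%g -> letter x gs n t.
Proof.
by move=> [[d d1 e]|[b bs e]]; [left; exists (- d)|right; exists (- b)];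
  rewrite ?abszN ?zpowN ?twistedN -?e ?invgK.
Qed.

Lemma twisted_letter (x : T) gs n (t : T) : twisted_set x gs n (sval t) -> letter x gs n t.
Proof.
rewrite /twisted_set /mkset inE => /orP[/eqP /sg_inj ->|/mapP[i]].
  by left; exists 1; rewrite ?zpow1.
by rewrite mem_iota => ilt /sg_inj ->; right; exists i.+1%:Z.
Qed.

Lemma twisted_girth (x : T) gs n :
  (forall w, (forall t, t \in w -> letter x gs n t) -> sorted (fun s t => s * t != 1)%g w ->
    (0 < size w < n)%N -> (\prod_(t <- w) t)%g <> 1%g) ->
  (n%:R%:E <= graph_girth R (cayley_graph H (twisted_set x gs n)))%E.
Proof.
move=> short; apply: le_ereal_inf_tmp => _ [c [ucyc sc] <-]; rewrite lee_fin ler_nat leqNgt; apply/negP => cn.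
have cH : {in c, forall g, g \in H}.
  move: ucyc => /andP[cyc _] g gc; have := next_cycle cyc gc.
  by rewrite /cayley_graph => /andP[].
have [c' ec] : exists c' : seq T, c = map sval c'.
  elim: c cH {ucyc sc cn} => [|g c IH] cH; first by exists [::].
  have [|c' ->] := IH; first by move=> k kc; apply: cH; rewrite inE kc orbT.
  by exists (sg_mk h (set_mem (cH g (mem_head _ _))) :: c').
have uc : ucycle (relpre sval (cayley_graph H (twisted_set x gs n))) c'.
  move: ucyc; rewrite /ucycle ec cycle_map map_inj_uniq//; exact: sg_inj.
have [||w [lw sw zw w1]] := @cycle_word _ _ (letter x gs n) _ _ uc.
- move=> g g' /= /and4P[_ _ _ /orP[]]; rewrite inE => gg'; first by apply: twisted_letter.
  by apply: letterV; apply: twisted_letter; rewrite invgM invgK.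
- by move: sc; rewrite ec size_map.
by apply: (short w) => //; rewrite zw; move: sc cn; rewrite ec size_map => sc ->; rewrite (ltn_trans _ sc).
Qed.

End Girth.

Section Interval.
Variable R : realType.

(** Extended by the identity, so as to act on the whole line. *)
Definition itv_fun (g : Sym (itv01 R)) (x : R) : R :=
  oapp (fun u : itv01 R => \val (g u)) x (insub x).

Lemma itv_funE g (u : itv01 R) : itv_fun g (\val u) = \val (g u).
Proof. by rewrite /itv_fun valK. Qed.

Lemma itv_in x : 0 <= x <= 1 -> exists u : itv01 R, \val u = x.
Proof. by move=> x01; exists (exist _ x (mem_set (x01 : itv01 R x))). Qed.

Lemma itv_val (u : itv01 R) : 0 <= \val u <= 1.
Proof. by have := set_mem (svalP u); rewrite /itv01 /= in_itv. Qed.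

Lemma itv_fun_out g x : ~ 0 <= x <= 1 -> itv_fun g x = x.
Proof.
move=> x01; rewrite /itv_fun insubN//; apply/negP => /set_mem; rewrite /itv01 /= in_itv; exact: x01.
Qed.

End Interval.

(** * Groups of interval homeomorphisms *)

Lemma homo_lt_le (R : realType) (g : itv01 R -> itv01 R) :
  {homo g : x y / \val x < \val y} -> {homo g : x y / \val x <= \val y}.
Proof. by move=> mono x y; rewrite le_eqVlt => /orP[/eqP/val_inj->|/mono/ltW]. Qed.

Section IntervalGroup.
Variables (R : realType) (Gamma : set (Sym (itv01 R))) (h : subgroup Gamma).
Hypothesis mono : forall g, Gamma g -> {homo (g : itv01 R -> itv01 R) : x y / \val x < \val y}.
Hypothesis fin : forall g, Gamma g -> g <> 1%g -> finite_set [set x : itv01 R | g x = x].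
Let T := subgroup_type h.

Let el (g : T) : Sym (itv01 R) := sval g.
Let sact (g : T) : R -> R := itv_fun (el g).

Lemma sactM g k x : sact (g * k)%g x = sact g (sact k x).
Proof.
have [/itv_in[u <-]|x01] := pselect (0 <= x <= 1); first by rewrite /sact !itv_funE.
by rewrite /sact !itv_fun_out.
Qed.

Lemma sact1 x : sact 1%g x = x.
Proof.
have [/itv_in[u <-]|x01] := pselect (0 <= x <= 1); first by rewrite /sact !itv_funE.
by rewrite /sact !itv_fun_out.
Qed.

Lemma sact_homo g x y : x < y -> sact g x < sact g y.
Proof.
have [/itv_in[u <-]|x01] := pselect (0 <= x <= 1);
  have [/itv_in[v <-]|y01] := pselect (0 <= y <= 1); rewrite /sact ?itv_funE ?(itv_fun_out _ x01) ?(itv_fun_out _ y01)//.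
- exact: (mono (sg_val (h := h) g)).
- by move=> uy; have := itv_val (el g u); have := itv_val u; lra.
- by move=> uy; have := itv_val (el g v); have := itv_val v; lra.
Qed.

Lemma sact_onto g (u : itv01 R) : exists v : itv01 R, el g v = u.
Proof. by exists ((el g)^-1%g u); rewrite -[LHS]/((el g * (el g)^-1)%g u) mulgV. Qed.

Lemma sact_0 g : sact g 0 = 0.
Proof.
have [|u u0] := @itv_in R 0; first by rewrite lexx ler01.
have [v gv] := sact_onto g u; rewrite -u0 /sact itv_funE.
have /(homo_lt_le (mono (sg_val (h := h) g))) : \val u <= \val v by rewrite u0; have /andP[] := itv_val v.
by rewrite gv u0 => le0; apply/eqP; rewrite eq_le le0; have /andP[] := itv_val (el g u).
Qed.

Lemma sact_end g : sact g 1 = 1.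
Proof.
have [|u u1] := @itv_in R 1; first by rewrite lexx ler01.
have [v gv] := sact_onto g u; rewrite -u1 /sact itv_funE.
have /(homo_lt_le (mono (sg_val (h := h) g))) : \val v <= \val u by rewrite u1; have /andP[] := itv_val v.
by rewrite gv u1 => le1; apply/eqP; rewrite eq_le; apply/andP; split=> //; have /andP[] := itv_val (el g u).
Qed.

Lemma sact_fin (g : T) : g <> 1%g -> exists s : seq R, forall x, 0 < x < 1 -> sact g x = x -> x \in s.
Proof.
move=> g1; have g1' : sval g <> 1%g by move=> e; apply: g1; exact: sg_inj.
have /finite_seqP[s sP] := fin (sg_val (h := h) g) g1'.
exists (map \val s) => x /andP[x0 x1].
have [|u <-] := @itv_in R x; first by rewrite !ltW.
rewrite /sact itv_funE => /val_inj gu; apply: map_f.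
suff : [set` s] u by [].
by rewrite -sP.
Qed.

Definition interval_action : itv_action R T :=
  ItvAction sactM sact1 sact_homo sact_0 sact_end sact_fin.

Lemma interval_near e g : dist_id (el g) < e -> near_id interval_action e g.
Proof.
move=> ge x /andP[x0 x1]; have [|u <-] := @itv_in R x; first by rewrite !ltW.
rewrite -[interval_action g _]/(itv_fun _ _) itv_funE; apply: le_lt_trans ge.
apply: sup_upper_bound; last by exists u.
split; first by exists `|\val (el g u) - \val u|, u.
exists 1 => _ [v _ <-]; have := itv_val v; have := itv_val (el g v).
by rewrite ler_norml => *; apply/andP; split; lra.
Qed.

End IntervalGroup.

(** * Affine embedding or infinite girth *)

Lemma affine_bij (R : realType) (r b : R) : 0 < r -> bijective (fun x => r * x + b).
Proof.
by move=> r0; exists (fun x => (x - b) / r) => x; field; rewrite lt0r_neq0.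
Qed.

Theorem proposition1p8 (R : realType) (Gamma : set (Sym (itv01 R))) :
  subgroup Gamma ->
  Gamma `<=` @Diff_plus R ->
  finitely_generated Gamma ->
  locally_transitive Gamma ->
  irreducible Gamma ->
  (forall g : Sym (itv01 R), Gamma g -> g <> 1%g ->
     finite_set [set x : itv01 R | g x = x]) ->
  (exists2 H : set (Sym R),
     subgroup H /\ H `<=` @Aff_plus R & isomorphic Gamma H)
  \/ girth R Gamma = +oo%E.
Proof.
move=> h Gdiff [S Sfin SG] Gtrans Girr Gfin.
have mono g : Gamma g -> {homo (g : itv01 R -> itv01 R) : x y / \val x < \val y}.
  by move=> /Gdiff[].
pose a := interval_action h mono Gfin.
have aE g (u : itv01 R) : a g (\val u) = \val ((sval g : Sym (itv01 R)) u) by exact: itv_funE.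
have irr p : 0 < p < 1 -> exists g, a g p <> p.
  move=> p01; have /andP[p0 p1] := p01; have [|u up] := @itv_in R p; first by rewrite !ltW.
  apply: contrapT => C; apply: Girr; exists u; split=> [|g Gg]; first by rewrite up.
  apply: contrapT => gu; apply: C; exists (sg_mk h Gg); rewrite -up aE => /val_inj; exact: gu.
have lt p : 0 < p < 1 -> forall e, 0 < e -> exists2 g, near_id a e g & a g p <> p.
  move=> p01 e e0; have /andP[p0 p1] := p01; have [|u up] := @itv_in R p; first by rewrite !ltW.
  have [|g [Gg ge gu]] := Gtrans u _ e e0; first by rewrite up.
  exists (sg_mk h Gg); first exact: interval_near.
  by rewrite -up aE => /val_inj.
have [chains|nchains] := pselect (forall k, exists2 m, pos a m & dominated_by (pos a) k m); last first.
  left.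
  have [rho [b [rho0 rhoM bM inj]]] : exists rho b : subgroup_type h -> R, affine_embedding rho b.
    have [triv|] := pselect (forall m, ~ pos a m).
      exists (fun=> 1), (fun=> 0); split=> // [g k|g k|g _ _]; rewrite ?mul1r ?addr0//.
      by case: (posT a g) => [e|p|p]; [exact: e|case: (triv _ p)|case: (triv _ p)].
    move=> /existsNP[m0 /contrapT Pm0].
    have [k [m Pm mk] kmax] : exists2 k, (exists2 m, pos a m & dominated_by (pos a) k m) &
        ~ exists2 m, pos a m & dominated_by (pos a) k.+1 m.
      apply: contrapT => C; apply: nchains; elim=> [|k IH]; first by exists m0.
      by apply: contrapT => nk; apply: C; exists k.
    by apply: (affine_ex irr Pm mk) => x Px xk; apply: kmax; exists x.
  (* The affine data exist on [Gamma] only; elsewhere the identity serves as a default. *)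
  have ext (g : Sym (itv01 R)) : exists f : Sym R, forall Gg : Gamma g,
      forall x, f x = rho (sg_mk h Gg) * x + b (sg_mk h Gg).
    have [Gg|nG] := pselect (Gamma g); last by exists 1%g.
    exists (MkSym (affine_bij (b (sg_mk h Gg)) (rho0 (sg_mk h Gg)))) => Gg' x.
    by rewrite (Prop_irrelevance Gg' Gg).
  have [phi phiP] := choice ext.
  have phiM : {in Gamma &, {morph phi : x y / (x * y)%g}}.
    move=> f g /set_mem Gf /set_mem Gg; apply: symP => x.
    rewrite (phiP _ (subgroupM h Gf Gg)) -[RHS]/(phi f (phi g x)) !(phiP _ Gf, phiP _ Gg).
    have -> : sg_mk h (subgroupM h Gf Gg) = (sg_mk h Gf * sg_mk h Gg)%g by exact: sg_inj.
    by rewrite rhoM bM; ring.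
  have phi1 : phi 1%g = 1%g.
    have G1 := mem_set (subgroup1 h); have := phiM _ _ G1 G1; rewrite mulg1 => e.
    by apply: (mulgI (phi 1%g)); rewrite mulg1 -e.
  have phiV g : Gamma g -> phi g^-1%g = (phi g)^-1%g.
    move=> Gg; apply: (mulgI (phi g)); rewrite mulgV -phi1 -(mulgV g) phiM//; first exact: mem_set.
    exact/mem_set/(subgroupV h).
  exists (phi @` Gamma); first split.
  - split; first by apply: mem_set; exists 1%g => //; exact: subgroup1.
    move=> _ _ /set_mem[f Gf <-] /set_mem[g Gg <-]; apply: mem_set; exists (f * g^-1)%g.
      by apply: (subgroupM h) => //; exact: (subgroupV h).
    by rewrite phiM ?phiV//; apply: mem_set => //; exact: (subgroupV h).
  - by move=> _ [g Gg <-]; exists (rho (sg_mk h Gg)), (b (sg_mk h Gg)); split=> [|x]; [exact: rho0|exact: phiP].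
  exists phi => //; split=> [g Gg|f g /set_mem Gf /set_mem Gg fg|//]; first by exists g.
  have Gfg := subgroupM h Gf (subgroupV h Gg).
  have e x : phi (f * g^-1)%g x = x.
    by rewrite phiM ?phiV//; [rewrite fg mulgV|exact: mem_set|exact/mem_set/(subgroupV h)].
  (* An affine map is determined by its values at 0 and 1. *)
  have b0 : b (sg_mk h Gfg) = 0 by have := e 0; rewrite (phiP _ Gfg) mulr0 add0r.
  have r1 : rho (sg_mk h Gfg) = 1 by have := e 1; rewrite (phiP _ Gfg) b0 addr0 mulr1.
  have /(congr1 sval) := inj _ r1 b0; rewrite sg1; exact: divg1_eq.
right; apply: eq_infty => r.
pose n := Num.bound r.
have /finite_seqP[s sS] := Sfin.
(* Trivial generators are dropped: they would fix the fixed points of [y]. *)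
have [gs gsP] : exists gs : seq (subgroup_type h), 1%g \notin gs /\
    forall t, t \in s -> t <> 1%g -> exists2 g, g \in gs & sval g = t.
  have sG t : t \in s -> Gamma t.
    by move=> ts; rewrite -SG; apply: sub_gen_smallest; rewrite sS.
  elim: s sG {sS} => [|t s IH] sG; first by exists [::].
  have [|gs [gs1 gsP]] := IH; first by move=> u us; apply: sG; rewrite inE us orbT.
  have [t1|t1] := pselect (t = 1%g).
    exists gs; split=> // u; rewrite inE => /orP[/eqP ->|/gsP//]; by rewrite t1.
  exists (sg_mk h (sG t (mem_head _ _)) :: gs); split.
    by rewrite inE negb_or gs1 andbT; apply/eqP => /(congr1 sval)/= /esym.
  move=> u; rewrite inE => /orP[/eqP -> _|us u1].
    by eexists; first exact: mem_head.
  by have [g ggs <-] := gsP u us u1; exists g; rewrite // inE ggs orbT.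
have [gs1 {}gsP] := gsP.
have [x xP] := short_words lt chains n gs1.
apply: (@le_trans _ _ n%:R%:E).
  rewrite lee_fin; have [r0|/ltW r0] := leP 0 r; last exact: le_trans r0 (ler0n _ _).
  exact/ltW/archi_boundP.
apply: le_trans (twisted_girth R xP) _; apply: ereal_sup_ubound.
exists (twisted_set x gs n) => //; split; first by apply/finite_seqP; eexists.
by apply: (generated_twisted _ _ SG) => t; rewrite sS => /gsP.
Qed.
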